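(* Let $\varphi\in\Phi$ be such that its right derivative $\psi^+$ is strictly increasing, and let $h_n,h\in L^{\psi^+}(\Omega)$ ($n\in\mathbb{N}$) satisfy $$\int_\Omega\psi^+(|h_n-h|)\,dx\to0\quad\text{as }n\to\infty,$$ and $|h_n(x)|\leqslant H(x)$ for a.e. $x\in\Omega$ and all $n$, with $H\in L^{\psi^+}(\Omega)$. Then $\mu_{\psi^+}(h_n)\to\mu_{\psi^+}(h)$ as $n\to\infty$.
   Context: $\Omega$ is a bounded Lebesgue measurable subset of $\mathbb{R}^n$ of positive measure; $\int_A f$ means $\int_{\Omega\cap A}f\,dx$ with Lebesgue measure. $\mathcal S$ is the set of non-decreasing functions $\psi:[0,\infty)\to[0,\infty)$ with $\psi(0)=0$, $\psi(s)>0$ for $s>0$, $\psi(s)\to0$ as $s\to0^+$ and $\psi(s)\to\infty$ as $s\to\infty$. A function $\psi$ satisfies the $\Delta_2$ condition if there is a constant $\Lambda_\psi>0$ with $\psi(2s)\leqslant\Lambda_\psi\psi(s)$ for all $s\ge0$. $\Phi$ is the class of functions $\varphi(s)=\int_0^s\psi(r)\,dr$ on $[0,\infty)$, with $\psi\in\mathcal S$, that satisfy the $\Delta_2$ condition. $\psi^-,\psi^+$ denote the left and right derivatives of $\varphi$, with $\psi^-(0)=\psi^+(0)=0$. $L^{\psi^+}(\Omega)$ is the class of real-valued Lebesgue measurable $f$ on $\Omega$ with $\int_\Omega\psi^+(|f|)\,dx<\infty$. $\Pi^m$ is the space of real algebraic polynomials on $\mathbb{R}^n$ of degree at most $m$.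 For $f\in L^{\psi^+}(\Omega)$, $\mu_{\psi^+}(f)$ is the set of all $P\in\Pi^m$ such that for all $Q\in\Pi^m$ $$\int_{\{f>P\}\cap\{Q>0\}}\psi^-(|f-P|)|Q|\,dx+\int_{\{f<P\}\cap\{Q<0\}}\psi^-(|f-P|)|Q|\,dx\leqslant\int_{\{f<P\}\cap\{Q>0\}}\psi^+(|f-P|)|Q|\,dx+\int_{\{f>P\}\cap\{Q<0\}}\psi^+(|f-P|)|Q|\,dx .$$ When $\psi^+$ is strictly increasing, $\mu_{\psi^+}(f)$ has exactly one element and is identified with that polynomial; convergence is in the finite-dimensional space $\Pi^m$ (equivalently, uniform convergence on $\Omega$). *)

(* Defs.v *)
From HB Require Import structures.
From mathcomp Require Import all_boot all_order all_algebra.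
(* The notations of mpoly clash with those of all_analysis. *)
From mathcomp Require Import -(notations) mpoly.
From mathcomp Require Import all_classical all_reals all_analysis.

Set Implicit Arguments.
Unset Strict Implicit.
Unset Printing Implicit Defensive.
Import Order.TTheory GRing.Theory Num.Theory.
Import numFieldNormedType.Exports.
Local Open Scope classical_set_scope.
Local Open Scope ring_scope.

Notation borel_Rn R n := (n.-tuple (measurableTypeR R)).

Section sigma_finite_copy.
Context d (T : measurableType d) (R : realType).
Variables (mu : {measure set T -> \bar R}) (mufin : sigma_finite setT mu).

Definition sigma_finite_copy of sigma_finite setT mu : set T -> \bar R := mu.

HB.instance Definition _ := Measure.on (sigma_finite_copy mufin).
HB.instance Definition _ :=
  Measure_isSigmaFinite.Build _ _ _ (sigma_finite_copy mufin) mufin.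

Lemma pack_sigma_finite :
  exists m : {sigma_finite_measure set T -> \bar R},
    m = mu :> (set T -> \bar R).
Proof. by exists (sigma_finite_copy mufin). Qed.

End sigma_finite_copy.

Section lebesgue_Rn.
Context {R : realType}.
Local Open Scope ereal_scope.

Definition cons_Rn (n : nat) (p : measurableTypeR R * borel_Rn R n) :
  borel_Rn R n.+1 := [tuple of p.1 :: p.2].

(* The n-fold product of the one-dimensional Lebesgue measure, on Borel sets;
   R^0 is a single point of mass 1. *)
Fixpoint borel_lebesgue (n : nat) : set (borel_Rn R n) -> \bar R :=
  match n with
  | 0 => \d_([tuple] : borel_Rn R 0)
  | n'.+1 => pushforward (lebesgue_measure \x @borel_lebesgue n') (@cons_Rn n')
  end.

Lemma measurable_cons_Rn n : measurable_fun setT (@cons_Rn n).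
Proof. exact: measurable_cons. Qed.

Definition uncons_Rn n (x : borel_Rn R n.+1) : measurableTypeR R * borel_Rn R n :=
  (thead x, [tuple of behead x]).

Lemma measurable_uncons_Rn n : measurable_fun setT (@uncons_Rn n).
Proof.
apply: measurable_fun_pair.
  exact: (@measurable_tnth _ (measurableTypeR R) n.+1 ord0).
exact: measurable_behead.
Qed.

Lemma sigma_finite_pushforward_cons n
    (m : {sigma_finite_measure set (borel_Rn R n) -> \bar R}) :
  sigma_finite setT (pushforward (lebesgue_measure \x m) (@cons_Rn n)).
Proof.
have /sigma_finiteP[F [TF ndF Foo]] := sigma_finiteT (@lebesgue_measure R).
have /sigma_finiteP[G [TG ndG Goo]] := sigma_finiteT m.
exists (fun k => @uncons_Rn n @^-1` (F k `*` G k)).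
  rewrite -preimage_bigcup (_ : \bigcup_k _ = setT) ?preimage_setT//.
  rewrite -setXTT TF TG predeqE => -[x y]; split.
    by move=> [k _ []/= ? ?]; split; exists k.
  move=> [/= [i _ Fix] [j _ Gjy]]; exists (maxn i j) => //; split.
  - by move: x Fix; exact/subsetPset/ndF/leq_maxl.
  - by move: y Gjy; exact/subsetPset/ndG/leq_maxr.
move=> k; have [mF Fk] := Foo k; have [mG Gk] := Goo k; split.
  rewrite -[X in measurable X]setTI; apply: measurable_uncons_Rn => //.
  exact: measurableX.
rewrite /pushforward -comp_preimage (_ : _ \o _ = id); last first.
  by apply/funext => -[x y]; congr pair; exact/val_inj.
by rewrite preimage_id product_measure1E// lte_mul_pinfty// ge0_fin_numE.
Qed.

Lemma borel_lebesgue_sigma_finite_measure n :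
  exists m : {sigma_finite_measure set (borel_Rn R n) -> \bar R},
    m = @borel_lebesgue n :> (set _ -> _).
Proof.
elim: n => [|n [m IH]].
  by exists (\d_([tuple] : borel_Rn R 0)).
have [nu nuE] := pack_sigma_finite
  (mu := measure_function_pushforward__canonical__measure_function_Measure
    (lebesgue_measure \x m) (@measurable_cons_Rn n))
  (sigma_finite_pushforward_cons m).
by exists nu; rewrite nuE /= -IH.
Qed.

Let borel_lebesgue0 n : @borel_lebesgue n set0 = 0.
Proof. by have [m <-] := borel_lebesgue_sigma_finite_measure n. Qed.

Let borel_lebesgue_ge0 n A : 0 <= @borel_lebesgue n A.
Proof. by have [m <-] := borel_lebesgue_sigma_finite_measure n. Qed.

Let borel_lebesgue_sigma_additive n :
  semi_sigma_additive (@borel_lebesgue n).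
Proof.
have [m <-] := borel_lebesgue_sigma_finite_measure n.
exact: measure_semi_sigma_additive.
Qed.

HB.instance Definition _ n := isMeasure.Build _ (borel_Rn R n) R
  (@borel_lebesgue n) (borel_lebesgue0 n) (@borel_lebesgue_ge0 n)
  (@borel_lebesgue_sigma_additive n).

Lemma sigma_finite_borel_lebesgue n : sigma_finite setT (@borel_lebesgue n).
Proof.
have [m <-] := borel_lebesgue_sigma_finite_measure n.
exact: sigma_finiteT.
Qed.

HB.instance Definition _ n :=
  @Measure_isSigmaFinite.Build _ (borel_Rn R n) R (@borel_lebesgue n)
    (@sigma_finite_borel_lebesgue n).

End lebesgue_Rn.

(* R^n with the sigma-algebra of the Lebesgue measurable sets, i.e., of the
   Caratheodory measurable sets for the Lebesgue outer measure. *)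
Definition Rn (R : realType) (n : nat) :=
  caratheodory_type (@borel_lebesgue R n)^*%mu.

HB.instance Definition _ (R : realType) (n : nat) := Measurable.on (Rn R n).

Definition lebesgue_Rn {R : realType} (n : nat) : set (Rn R n) -> \bar R :=
  @completed_measure_extension _ (borel_Rn R n) R (@borel_lebesgue R n).

HB.instance Definition _ (R : realType) (n : nat) :=
  Measure.on (@lebesgue_Rn R n).

HB.instance Definition _ (R : realType) (n : nat) :=
  @Measure_isSigmaFinite.Build _ (Rn R n) R (@lebesgue_Rn R n)
    (completed_measure_extension_sigma_finite
      (@sigma_finite_borel_lebesgue R n)).

Definition bounded_Rn (R : realType) (n : nat) (A : set (Rn R n)) : Prop :=
  exists M : R, forall x, A x -> forall i, `|tnth x i| <= M.

Section class_Phi.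
Context {R : realType}.
Implicit Types (psi phi : R -> R) (s r : R).

(* Functions on [0, +oo[ are encoded as functions on R whose values on
   negative numbers are never used. *)

Definition class_S psi : Prop :=
  [/\ {in `[0, +oo[ &, {homo psi : x y / x <= y}},
      psi 0 = 0,
      forall s, 0 < s -> 0 < psi s,
      psi s @[s --> 0^'+] --> 0 &
      psi s @[s --> +oo%R] --> +oo%R].

Definition Delta2 phi : Prop :=
  exists2 Lambda : R, 0 < Lambda &
    forall s, 0 <= s -> phi (2 * s) <= Lambda * phi s.

Definition class_Phi phi : Prop :=
  (exists2 psi, class_S psi &
    forall s, 0 <= s ->
      (phi s)%:E = (\int[lebesgue_measure]_(r in `[0%R, s]) (psi r)%:E)%E) /\
  Delta2 phi.

(* At 0 both are 0 by convention, since phi is only meaningful on [0, +oo[. *)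
Definition psi_minus phi s : R :=
  if s == 0 then 0 else lim ((phi (s + t) - phi s) / t @[t --> 0^'-]).

Definition psi_plus phi s : R :=
  if s == 0 then 0 else lim ((phi (s + t) - phi s) / t @[t --> 0^'+]).

End class_Phi.

Section best_approximation.
Context {R : realType} {n : nat}.
Variables (Omega : set (Rn R n)) (phi : R -> R).
Implicit Types f : Rn R n -> R.

Definition L_psi_plus f : Prop :=
  measurable_fun Omega f /\
  (\int[@lebesgue_Rn R n]_(x in Omega) (psi_plus phi `|f x|)%:E < +oo)%E.

(* [msize] is the total degree plus one, and 0 for the zero polynomial. *)
Definition Pi_space (m : nat) : set (mpoly n R) :=
  [set P | (msize P <= m.+1)%N].

Definition poly_fun (P : mpoly n R) : Rn R n -> R :=
  fun x => meval (tnth x) P.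

(* The integral over Omega `&` D of psi (|f - P|) |Q|. *)
Definition weighted_integral (psi : R -> R) f (P Q : mpoly n R)
    (D : set (Rn R n)) : \bar R :=
  (\int[@lebesgue_Rn R n]_(x in Omega `&` D)
    (psi `|f x - poly_fun P x| * `|poly_fun Q x|)%:E)%E.

Definition mu_psi_plus (m : nat) f : set (mpoly n R) :=
  [set P | Pi_space m P /\ forall Q, Pi_space m Q ->
    (weighted_integral (psi_minus phi) f P Q
       [set x | (f x > poly_fun P x)%R /\ (poly_fun Q x > 0)%R] +
     weighted_integral (psi_minus phi) f P Q
       [set x | (f x < poly_fun P x)%R /\ (poly_fun Q x < 0)%R] <=
     weighted_integral (psi_plus phi) f P Q
       [set x | (f x < poly_fun P x)%R /\ (poly_fun Q x > 0)%R] +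
     weighted_integral (psi_plus phi) f P Q
       [set x | (f x > poly_fun P x)%R /\ (poly_fun Q x < 0)%R])%E].

End best_approximation.

(* Convergence in the finite-dimensional space of the polynomials of degree at
   most m, i.e., convergence of the coordinates in the basis of monomials. *)
Definition poly_cvg (R : realType) (n : nat) (P_ : nat -> mpoly n R)
    (P : mpoly n R) : Prop :=
  forall k : multinom n,
    mcoeff k (P_ i) @[i --> \oo] --> mcoeff k P.

(* Main.v *)
(* Write psi- and psi+ for the one-sided derivatives of phi; P belongs to mu(f)
   iff every one-sided directional derivative of P |-> \int phi(|f - P|) at P is
   nonnegative. Suppose P_k does not converge to P. Since phi(|.|) is convex,
   the derivative at P_k towards P stays nonnegative when P_k is moved along the
   segment to the point P + E_k at a fixed distance eps from P, so no separate
   bound on P_k is needed. By compactness, along a subsequence E_k tends to some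
   E <> 0 and h_k tends to h almost everywhere. The derivative at P for h in the
   direction E_k and the one at P + E_k for h_k in the direction -E_k add up to
   the integral of |E_k| (psi(h_k - P - E_k) - psi(h - P)), up to one-sided
   versions and signs. Its integrand is bounded above by an integrable function,
   and, psi+ being strictly increasing, it is eventually bounded away from 0 by a
   negative number at every point with E <> 0, hence almost everywhere. Fatou's
   lemma contradicts the nonnegativity of the integral. *)

Require Import Defs.
From HB Require Import structures.
From mathcomp Require Import all_boot all_order all_algebra.
From mathcomp Require Import -(notations) mpoly.
From mathcomp Require Import all_classical all_reals all_analysis.
From mathcomp Require Import measurable_realfun.
From mathcomp Require Import lra.
Import Order.TTheory GRing.Theory Num.Theory.
Import numFieldNormedType.Exports.
Local Open Scope classical_set_scope.
Local Open Scope ring_scope.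

Set Implicit Arguments.
Unset Strict Implicit.
Unset Printing Implicit Defensive.

(** * One-sided derivatives of a function of class Phi *)

(** The increment of [phi] is the integral of [psi] over []a, b]], and a monotone integrand lies
    there between its values at the endpoints. *)
Lemma class_Phi_increment (R : realType) (psi phi : R -> R) :
  class_S psi ->
  (forall s, 0 <= s ->
    (phi s)%:E = (\int[lebesgue_measure]_(r in `[0%R, s]) (psi r)%:E)%E) ->
  forall a b, 0 <= a -> a <= b ->
    psi a * (b - a) <= phi b - phi a <= psi b * (b - a).
Proof.
move=> [psi_nd psi0 psi_gt0 _ _] phiE a b a0 ab.
(* [f] extends [psi] by [psi 0] to the negative numbers; it is monotone on the whole line, hence
   measurable. *)
pose f (x : R) := psi (Num.max 0 x).
have f_nd : nondecreasing_fun f.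
  move=> x y xy; apply: psi_nd; rewrite ?in_itv/= ?andbT.
  - by rewrite le_max lexx.
  - by rewrite le_max lexx.
  - by rewrite ge_max !le_max lexx xy orbT.
have f_ge0 x : 0 <= f x.
  by rewrite /f /Order.max; case: ifPn => [/psi_gt0/ltW//|_]; rewrite psi0.
have fE x : 0 <= x -> f x = psi x by move=> x0; rewrite /f max_r.
have mf (D : set (measurableTypeR R)) :
    measurable D -> measurable_fun D (EFin \o f).
  by move=> mD; apply/measurable_EFinP; exact: nondecreasing_measurable.
have {}phiE s : 0 <= s ->
    (phi s)%:E = (\int[lebesgue_measure]_(r in `[0%R, s]) (f r)%:E)%E.
  move=> s0; rewrite phiE//; apply: eq_integral => x.
  by rewrite inE/= in_itv/= => /andP[x0 _]; rewrite fE.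
have b0 : 0 <= b by exact: le_trans ab.
have split_ab : (phi b)%:E =
    ((phi a)%:E + \int[lebesgue_measure]_(r in `]a, b]) (f r)%:E)%E.
  rewrite !phiE// -ge0_integral_setU//=.
  - by congr integral; rewrite -itv_bndbnd_setU// bnd_simp.
  - by apply: mf; exact: measurableU.
  - by move=> x _; rewrite lee_fin.
  - rewrite disj_set2E; apply/eqP/seteqP; split => x //=.
    rewrite !in_itv/= => -[/andP[_ xa] /andP[ax _]].
    by move: (lt_le_trans ax xa); rewrite ltxx.
have cstE c : (\int[lebesgue_measure]_(r in `]a, b]) (c%:E : \bar R) =
    (c * (b - a))%:E)%E.
  rewrite integral_cst//= lebesgue_measure_itv/= lte_fin.
  have [_|ba] := ltP a b; first by rewrite -EFinB -EFinM.
  by rewrite mule0 (@le_anti _ _ a b) ?ab// subrr mulr0.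
have lo : ((psi a * (b - a))%:E <=
    \int[lebesgue_measure]_(r in `]a, b]) (f r)%:E)%E.
  rewrite -cstE; apply: ge0_le_integral => //=.
  - by move=> x _; rewrite lee_fin -fE.
  - exact: mf.
  - by move=> x; rewrite in_itv/= => /andP[/ltW ax _]; rewrite lee_fin -fE// f_nd.
have hi : (\int[lebesgue_measure]_(r in `]a, b]) (f r)%:E <=
    (psi b * (b - a))%:E)%E.
  rewrite -cstE; apply: ge0_le_integral => //=.
  - by move=> x _; rewrite lee_fin.
  - exact: mf.
  - by move=> x; rewrite in_itv/= => /andP[_ xb]; rewrite lee_fin -fE// f_nd.
have eqI : (\int[lebesgue_measure]_(r in `]a, b]) (f r)%:E =
    (phi b - phi a)%:E)%E.
  by rewrite EFinB split_ab [X in (X - _)%E]addeC addeK.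
by move: lo hi; rewrite eqI !lee_fin => -> ->.
Qed.

(** Difference quotients of the convex function [phi] are monotone in the increment and bounded by
    values of [psi], so the limits defining [psi_minus] and [psi_plus] exist and inherit these
    bounds. The last two claims place the slope of a chord between the inner one-sided derivatives
    at its ends. *)
Lemma class_Phi_psi_bounds (R : realType) (psi phi : R -> R) :
  class_S psi ->
  (forall s, 0 <= s ->
    (phi s)%:E = (\int[lebesgue_measure]_(r in `[0%R, s]) (psi r)%:E)%E) ->
  [/\ forall a, 0 <= a -> 0 <= psi_minus phi a <= psi a,
      forall a, 0 <= a -> psi a <= psi_plus phi a,
      forall a b, 0 <= a -> a < b -> psi_plus phi a * (b - a) <= phi b - phi a &
      forall a b, 0 <= a -> a < b -> phi b - phi a <= psi_minus phi b * (b - a)].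
Proof.
move=> psiS phiE; have inc := @class_Phi_increment _ _ _ psiS phiE.
have [psi_nd psi0 psi_gt0 _ _] := psiS.
have psi_ge0 x : 0 <= x -> 0 <= psi x.
  by rewrite le_eqVlt => /predU1P[<-|/psi_gt0/ltW//]; rewrite psi0.
pose slope s t := (phi (s + t) - phi s) / t.
have slopeR s t : 0 <= s -> 0 < t -> psi s <= slope s t <= psi (s + t).
  move=> s0 t0; have st : s <= s + t by rewrite lerDl ltW.
  by rewrite /slope ler_pdivrMr// ler_pdivlMr//; have := inc _ _ s0 st;
    rewrite addrAC subrr add0r.
have slopeL s t : t < 0 -> 0 <= s + t -> psi (s + t) <= slope s t <= psi s.
  move=> t0 st0; have st : s + t <= s by rewrite gerDl ltW.
  rewrite /slope ler_ndivrMr// ler_ndivlMr// andbC.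
  have := inc _ _ st0 st; rewrite opprD addrA subrr add0r !mulrN.
  by move=> /andP[? ?]; apply/andP; split; lra.
(* The quotient for [t'] is a weighted mean of the quotient for [t] and the slope over
   [[s + t, s + t']]; the value [psi (s + t)] separates these two. *)
have slope_ndR s t t' : 0 <= s -> 0 < t -> t <= t' -> slope s t <= slope s t'.
  move=> s0 t0 tt'; have t'0 := lt_le_trans t0 tt'.
  have /andP[_] := slopeR s t s0 t0; rewrite /slope ler_pdivrMr// => h1.
  have := inc (s + t) (s + t'); rewrite lerD2l addr_ge0 ?(ltW t0)//.
  move=> /(_ isT tt')/andP[h2 _]; rewrite ler_pdivrMr// mulrAC ler_pdivlMr//.
  nra.
have slope_ndL s t t' : t' < 0 -> 0 <= s + t -> t <= t' -> slope s t <= slope s t'.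
  move=> t'0 st0 tt'; have t0 := le_lt_trans tt' t'0.
  have st'0 : 0 <= s + t' by rewrite (le_trans st0)// lerD2l.
  have /andP[+ _] := slopeL s t' t'0 st'0; rewrite /slope ler_ndivlMr// => h1.
  have := inc (s + t) (s + t'); rewrite lerD2l => /(_ st0 tt')/andP[_ h2].
  rewrite ler_ndivlMr// mulrAC ler_ndivlMr//.
  nra.
have plus_cvg s : 0 < s -> cvg (slope s t @[t --> 0^'+]).
  move=> s0; apply: nondecreasing_at_right_is_cvgr.
    near=> e => t t' ; rewrite !in_itv/= => /andP[t0 _] /andP[_ _].
    by apply: slope_ndR => //; exact: ltW.
  near=> e; exists (psi s) => _ [t /=] + <-; rewrite in_itv/= => /andP[t0 _].
  by have /andP[] := slopeR s t (ltW s0) t0.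
have minus_cvg s : 0 < s -> cvg (slope s t @[t --> 0^'-]).
  move=> s0; have Ns : - s < 0 by rewrite oppr_lt0.
  apply: nondecreasing_at_left_is_cvgr.
    near=> e => t t' ; rewrite !in_itv/= => /andP[et _] /andP[_ t'0] tt'.
    apply: slope_ndL => //; rewrite -lerBlDl sub0r (le_trans _ (ltW et))//.
    by near: e; exact: nbhs_left_ge.
  near=> e; exists (psi s) => _ [t /=] + <-; rewrite in_itv/= => /andP[et t0].
  have st : 0 <= s + t.
    rewrite -lerBlDl sub0r (le_trans _ (ltW et))//.
    by near: e; exact: nbhs_left_ge.
  by have /andP[] := slopeL s t t0 st.
have plus_ge s : 0 <= s -> psi s <= psi_plus phi s.
  rewrite /psi_plus; case: eqVneq => [->|s_neq0 s0]; first by rewrite psi0.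
  have s_gt0 : 0 < s by rewrite lt0r s_neq0.
  apply: limr_ge; first exact: plus_cvg.
  near=> t; have t0 : 0 < t by near: t; exact: nbhs_right_gt.
  by have /andP[] := slopeR s t s0 t0.
have plus_le s t : 0 <= s -> 0 < t -> psi_plus phi s <= slope s t.
  rewrite /psi_plus; case: eqVneq => [->|s_neq0] s0 t0.
    by apply: le_trans (andP (slopeR _ _ s0 t0)).1; rewrite psi0.
  have s_gt0 : 0 < s by rewrite lt0r s_neq0.
  apply: limr_le; first exact: plus_cvg.
  near=> u; apply: slope_ndR => //.
  by near: u; exact: nbhs_right_le.
have minus_le s : 0 <= s -> psi_minus phi s <= psi s.
  rewrite /psi_minus; case: eqVneq => [->|s_neq0 s0]; first by rewrite psi0.
  have s_gt0 : 0 < s by rewrite lt0r s_neq0.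
  have Ns : - s < 0 by rewrite oppr_lt0.
  apply: limr_le; first exact: minus_cvg.
  near=> t; have t0 : t < 0 by near: t; exact: nbhs_left_lt.
  have st : 0 <= s + t by rewrite -lerBlDl sub0r; near: t; exact: nbhs_left_ge.
  by have /andP[] := slopeL s t t0 st.
have minus_ge s t : t < 0 -> 0 <= s + t -> slope s t <= psi_minus phi s.
  move=> t0 st; have s_gt0 : 0 < s by rewrite -(ltrD2r t) add0r (lt_le_trans t0).
  rewrite /psi_minus gt_eqF//.
  apply: limr_ge; first exact: minus_cvg.
  near=> u; apply: slope_ndL => //.
  by near: u; exact: nbhs_left_ge.
split => //.
- move=> a a0; rewrite minus_le// andbT.
  have [->|an0] := eqVneq a 0; first by rewrite /psi_minus eqxx.
  have a_gt0 : 0 < a by rewrite lt0r an0.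
  apply: le_trans (minus_ge a (- a) _ _); rewrite ?oppr_lt0 ?subrr//.
  have := slopeL a (- a).
  by rewrite oppr_lt0 subrr psi0 => /(_ a_gt0 (lexx _))/andP[].
- move=> a b a0 ab; have ba : 0 < b - a by rewrite subr_gt0.
  by have := plus_le a (b - a) a0 ba; rewrite /slope subrKC ler_pdivlMr.
- move=> a b a0 ab; have ba : a - b < 0 by rewrite subr_lt0.
  have := minus_ge b (a - b) ba; rewrite subrKC => /(_ a0).
  by rewrite /slope subrKC ler_ndivrMr//; lra.
Unshelve. all: by end_near. Qed.

(** Doubling passes from [phi] to its right derivative: [psi_plus phi (2 * s) * (2 * s)] is at most
    the increment of [phi] from [2 * s] to [4 * s], two doublings bound [phi (4 * s)] by
    [L * L * phi s], and [phi s <= psi_plus phi s * s]. *)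
Lemma class_Phi_psi_Delta2 (R : realType) (phi : R -> R) :
  class_Phi phi ->
  exists2 C : R, 0 <= C &
    forall s, 0 <= s -> psi_plus phi (2 * s) <= C * psi_plus phi s.
Proof.
move=> [[psi psiS phiE] [L L0 D2]].
have [_ plus_ge plus_le _] := class_Phi_psi_bounds psiS phiE.
have inc := @class_Phi_increment _ _ _ psiS phiE.
have [_ psi0 psi_gt0 _ _] := psiS.
exists (L * L) => [|s]; first by rewrite mulr_ge0// ltW.
rewrite le_eqVlt => /predU1P[<-|s0].
  by rewrite mulr0 /psi_plus eqxx mulr0.
have phi0 : phi 0 = 0.
  by apply: EFin_inj; rewrite phiE// set_itv1 integral_set1.
have phi_ge0 x : 0 <= x -> 0 <= phi x.
  by move=> x0; have := inc _ _ (lexx 0) x0; rewrite phi0 psi0 mul0r subr0 => /andP[].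
have h1 := plus_le (2 * s) (2 * (2 * s)).
have {}h1 : psi_plus phi (2 * s) * (2 * (2 * s) - 2 * s) <=
    phi (2 * (2 * s)) - phi (2 * s) by apply: h1; lra.
have h2 := phi_ge0 (2 * s); have {}h2 : 0 <= phi (2 * s) by apply: h2; lra.
have h3 := D2 (2 * s); have {}h3 : phi (2 * (2 * s)) <= L * phi (2 * s).
  by apply: h3; lra.
have h4 := D2 s (ltW s0).
have /andP[_ h5] := inc _ _ (lexx 0) (ltW s0).
have h6 := plus_ge s (ltW s0).
rewrite phi0 !subr0 in h5.
have h7 : phi s <= psi_plus phi s * s by rewrite (le_trans h5)// ler_wpM2r// ltW.
have h8 : phi (2 * (2 * s)) <= L * (L * (psi_plus phi s * s)).
  by rewrite (le_trans h3)// ler_wpM2l ?(ltW L0)// (le_trans h4)// ler_wpM2l// ltW.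
have h9 : psi_plus phi (2 * s) * s <= L * (L * (psi_plus phi s * s)).
  have : 0 <= psi_plus phi s * s by rewrite (le_trans _ h7)// phi_ge0// ltW.
  move=> /(mulr_ge0 (ltW L0))/(mulr_ge0 (ltW L0)); lra.
by rewrite -(ler_pM2r s0) -!mulrA.
Qed.

(** * Pointwise directional derivatives *)

Section one_sided_integrands.
Variables (R : realType) (p q : R -> R).
Hypothesis p0 : p 0 = 0.
(** In the application [p] is the right and [q] the left derivative of [phi]. With [qp_le], this
    crossed inequality makes both of them strictly increasing. *)
Hypothesis pq_lt : forall s t, 0 <= s -> s < t -> p s < q t.
Hypothesis qp_le : forall t, 0 <= t -> q t <= p t.

(* With u the value of f - P and c that of the direction Q at a point,
   rise_rate u c - drop_rate u c is the right derivative at 0 of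
   t |-> phi |u - t c|. *)
Definition drop_rate (u c : R) := if 0 < u * c then q `|u| * `|c| else 0.
Definition rise_rate (u c : R) := if u * c < 0 then p `|u| * `|c| else 0.

(** [left_slope] and [right_slope] are the one-sided derivatives of the even function u |-> phi |u|;
    on the negative side reflection exchanges [p] and [q]. *)
Definition left_slope u :=
  if 0 < u then q u else if u < 0 then - p (- u) else 0.
Definition right_slope u :=
  if 0 < u then p u else if u < 0 then - q (- u) else 0.

Lemma p_nondecreasing s t : 0 <= s -> s <= t -> p s <= p t.
Proof.
move=> s0; rewrite le_eqVlt => /predU1P[->//|st].
by apply: ltW; apply: lt_le_trans (pq_lt s0 st) _; rewrite qp_le// ltW// (le_lt_trans s0).
Qed.

Lemma p_increasing s t : 0 <= s -> s < t -> p s < p t.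
Proof.
move=> s0 st; apply: lt_le_trans (pq_lt s0 st) _.
by rewrite qp_le// ltW// (le_lt_trans s0).
Qed.

Lemma p_ge0 s : 0 <= s -> 0 <= p s.
Proof. by move=> s0; rewrite -p0 p_nondecreasing. Qed.

Lemma p_gt0 s : 0 < s -> 0 < p s.
Proof. by move=> s0; rewrite -p0 p_increasing. Qed.

Lemma q_gt0 s : 0 < s -> 0 < q s.
Proof. by move=> s0; rewrite -p0 pq_lt. Qed.

Lemma q_nondecreasing s t : 0 < s -> s <= t -> q s <= q t.
Proof.
move=> s0; rewrite le_eqVlt => /predU1P[->//|st].
by apply: ltW; apply: le_lt_trans (qp_le (ltW s0)) (pq_lt _ _); rewrite // ltW.
Qed.

Lemma drop_rate_ge0 u c : 0 <= drop_rate u c.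
Proof.
rewrite /drop_rate; case: ifPn => // uc; rewrite mulr_ge0//.
by rewrite ltW// q_gt0// normr_gt0; apply: contraTneq uc => ->; rewrite mul0r ltxx.
Qed.

Lemma rise_rate_ge0 u c : 0 <= rise_rate u c.
Proof. by rewrite /rise_rate; case: ifPn => // uc; rewrite mulr_ge0// p_ge0. Qed.

Lemma rise_rate_le u c : rise_rate u c <= p `|u| * `|c|.
Proof. by rewrite /rise_rate; case: ifPn => // _; rewrite mulr_ge0// p_ge0. Qed.

Lemma drop_rateN u c : drop_rate (- u) (- c) = drop_rate u c.
Proof. by rewrite /drop_rate mulrNN !normrN. Qed.

Lemma rise_rateN u c : rise_rate (- u) (- c) = rise_rate u c.
Proof. by rewrite /rise_rate mulrNN !normrN. Qed.

(* By convexity, a descent direction at u - e is one at u - s e as well. *)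
Lemma drop_rate_segment u e s : 1 <= s ->
  drop_rate (u - e) (- e) <= drop_rate (u - s * e) (- e).
Proof.
move=> s1; rewrite {1}/drop_rate; case: ifPn => [ue|_]; last exact: drop_rate_ge0.
have ue' : (u - e) * (- e) <= (u - s * e) * (- e).
  have : 0 <= (s - 1) * e ^+ 2 by rewrite mulr_ge0 ?subr_ge0 ?sqr_ge0.
  by lra.
rewrite /drop_rate (lt_le_trans ue ue') ler_wpM2r// q_nondecreasing//.
  by rewrite normr_gt0; apply: contraTneq ue => ->; rewrite mul0r ltxx.
have e_gt0 : 0 < `|- e|.
  by rewrite normr_gt0; apply: contraTneq ue => ->; rewrite mulr0 ltxx.
by rewrite -(ler_pM2r e_gt0) -!normrM !ger0_norm// ltW// (lt_le_trans ue).
Qed.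

(** The product [(u - s * e) * (- e)] is nondecreasing in [s]. If it is negative at [s], it is at
    least as negative at 1, and dividing by [|e|] compares the moduli fed to [p]. *)
Lemma rise_rate_segment u e s : 1 <= s ->
  rise_rate (u - s * e) (- e) <= rise_rate (u - e) (- e).
Proof.
move=> s1; rewrite {1}/rise_rate; case: ifPn => [ue|_]; last exact: rise_rate_ge0.
have ue' : (u - e) * (- e) <= (u - s * e) * (- e).
  have : 0 <= (s - 1) * e ^+ 2 by rewrite mulr_ge0 ?subr_ge0 ?sqr_ge0.
  by lra.
rewrite /rise_rate (le_lt_trans ue' ue) ler_wpM2r// p_nondecreasing//.
have e_gt0 : 0 < `|- e|.
  by rewrite normr_gt0; apply: contraTneq ue => ->; rewrite mulr0 ltxx.
rewrite -(ler_pM2r e_gt0) -!normrM !ltr0_norm ?lerN2//.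
exact: le_lt_trans ue' ue.
Qed.

(** Moving along u - t c with [c > 0] approaches [u] from the left, so the left derivative appears;
    the direction [- c] produces the right one in [right_slopeE]. *)
Lemma left_slopeE u c : 0 < c ->
  drop_rate u c - rise_rate u c = c * left_slope u.
Proof.
move=> c0; rewrite /drop_rate /rise_rate /left_slope pmulr_lgt0// pmulr_llt0//.
rewrite (gtr0_norm c0); case: ltgtP => u0; rewrite ?subr0 ?sub0r ?mulr0//.
  by rewrite gtr0_norm// mulrC.
by rewrite ltr0_norm// mulrN mulrC.
Qed.

Lemma right_slopeE u c : 0 < c ->
  rise_rate u (- c) - drop_rate u (- c) = c * right_slope u.
Proof.
move=> c0; rewrite /drop_rate /rise_rate /right_slope !mulrN oppr_gt0 oppr_lt0.
rewrite pmulr_lgt0// pmulr_llt0// normrN (gtr0_norm c0).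
case: ltgtP => u0; rewrite ?subr0 ?sub0r ?mulr0//.
  by rewrite gtr0_norm// mulrC.
by rewrite ltr0_norm// mulrN mulrC.
Qed.

(** Strict convexity of u |-> phi |u|, the source of the gap in [rates_gap]. On one side of 0 it is
    [pq_lt]; otherwise the signs of the slopes decide. *)
Lemma right_slope_lt a b : b < a -> right_slope b < left_slope a.
Proof.
rewrite /right_slope /left_slope => ba.
case: (ltgtP 0 a) => a0; case: (ltgtP 0 b) => b0.
- by rewrite pq_lt// ltW.
- by rewrite (lt_trans _ (q_gt0 a0))// oppr_lt0 q_gt0// oppr_gt0.
- exact: q_gt0.
- by move: (lt_trans b0 (lt_trans ba a0)); rewrite ltxx.
- by rewrite ltrN2 pq_lt ?oppr_ge0 ?ltW// ltrN2.
- by move: ba; rewrite -b0 => /(lt_trans a0); rewrite ltxx.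
- by move: ba; rewrite -a0 => /(lt_trans b0); rewrite ltxx.
- by rewrite oppr_lt0 q_gt0// oppr_gt0.
- by move: ba; rewrite -a0 -b0 ltxx.
Qed.

Lemma left_slope_le a : left_slope a <= right_slope a.
Proof.
rewrite /right_slope /left_slope; case: ltgtP => // a0; first by rewrite qp_le// ltW.
by rewrite lerN2 qp_le// oppr_ge0 ltW.
Qed.

Lemma right_slope_nondecreasing a b : b <= a -> right_slope b <= right_slope a.
Proof.
rewrite le_eqVlt => /predU1P[->//|/right_slope_lt/ltW ba].
exact: le_trans ba (left_slope_le a).
Qed.

Lemma rates_gap_pos (u e : R) (e_ b_ : R^nat) : 0 < e ->
  e_ @ \oo --> e -> b_ @ \oo --> u - e ->
  exists2 dlt, 0 < dlt & \forall k \near \oo,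
    rise_rate u (e_ k) + rise_rate (b_ k) (- e_ k) + dlt <=
    drop_rate u (e_ k) + drop_rate (b_ k) (- e_ k).
Proof.
move=> e0 e_e b_b.
(* The slopes may jump, so they need not converge along [b_]. A fixed [c] strictly between [u - e]
   and [u] lies eventually above [b_ k], and monotonicity bounds the slope at [b_ k] by the one at
   [c]. The factor [e / 2] bounds [e_ k] from below. *)
pose c := u - e / 2.
have cu : c < u by rewrite gtrBl divr_gt0.
have bc : u - e < c by rewrite /c; lra.
have gap : 0 < left_slope u - right_slope c by rewrite subr_gt0 right_slope_lt.
exists (e / 2 * (left_slope u - right_slope c)).
  by rewrite mulr_gt0// divr_gt0.
have e2 : e / 2 < e by lra.
near=> k.
have ek : e / 2 < e_ k by near: k; exact: cvgr_gt e_e _ e2.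
have ek0 : 0 < e_ k by rewrite (lt_trans _ ek)// divr_gt0.
have bk : b_ k < c by near: k; exact: cvgr_lt b_b _ bc.
have h1 := left_slopeE u ek0.
have h2 := right_slopeE (b_ k) ek0.
have h3 := right_slope_nondecreasing (ltW bk).
have h4 : e / 2 * (left_slope u - right_slope c) <=
    e_ k * (left_slope u - right_slope (b_ k)).
  by apply: ler_pM; [rewrite divr_ge0// ltW|exact: ltW|exact: ltW|exact: lerB].
lra.
Unshelve. all: by end_near. Qed.

Lemma rates_gap (u e : R) (e_ b_ : R^nat) : e != 0 ->
  e_ @ \oo --> e -> b_ @ \oo --> u - e ->
  exists2 dlt, 0 < dlt & \forall k \near \oo,
    rise_rate u (e_ k) + rise_rate (b_ k) (- e_ k) + dlt <=
    drop_rate u (e_ k) + drop_rate (b_ k) (- e_ k).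
Proof.
move=> e0 e_e b_b; have [e_lt0|e_gt0|e_eq0] := ltgtP e 0; last 2 first.
- exact (rates_gap_pos e_gt0 e_e b_b).
- by move: e0; rewrite e_eq0 eqxx.
(* Both rates are invariant under a simultaneous change of sign of the point and the direction. *)
have := @rates_gap_pos (- u) (- e) (- e_) (- b_).
rewrite oppr_gt0 => /(_ e_lt0 (cvgN e_e)).
have Nb : (- b_) k @[k --> \oo] --> - u - - e.
  rewrite (_ : - u - - e = - (u - e)); first exact: (cvgN b_b).
  by rewrite opprB opprK addrC.
move=> /(_ Nb)[dlt dlt0 near_dlt]; exists dlt => //.
apply: filterS near_dlt => k /=.
by rewrite !fctE !drop_rateN !rise_rateN.
Qed.

End one_sided_integrands.

(** * Integral estimates *)

Lemma le_limn_einf (R : realType) (u : (\bar R)^nat) (l : \bar R) :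
  (\forall k \near \oo, (l <= u k)%E) -> (l <= limn_einf u)%E.
Proof.
move=> [N _ lu]; rewrite limn_einf_lim; apply: lime_ge; first exact: is_cvg_einfs.
near=> k; apply: le_ereal_inf_tmp => _ [j /= kj <-]; apply: lu => /=.
by rewrite (leq_trans _ kj)//; near: k; exact: nbhs_infty_ge.
Unshelve. all: by end_near. Qed.

Lemma ae_false_measure0 d (T : measurableType d) (R : realType)
    (mu : {measure set T -> \bar R}) (D : set T) :
  measurable D -> {ae mu, forall x, ~ D x} -> mu D = 0.
Proof.
move=> mD Dae; apply: measure_negligible => //.
by apply: negligibleS Dae => x Dx /=; exact.
Qed.

(** Fatou's lemma is applied to W_k + (g - V_k): these functions have integral at most that of [g],
    but the pointwise gap makes their lower limit exceed [g] almost everywhere on a set of positive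
    measure. *)
Lemma fatou_gap d (T : measurableType d) (R : realType)
    (mu : {measure set T -> \bar R}) (D : set T) (V W : nat -> T -> R) (g : T -> R) :
  measurable D -> (0 < mu D)%E ->
  (forall k, measurable_fun D (V k)) -> (forall k, measurable_fun D (W k)) ->
  measurable_fun D g ->
  (forall k x, 0 <= V k x) -> (forall k x, 0 <= W k x) -> (forall x, 0 <= g x) ->
  (\int[mu]_(x in D) (g x)%:E < +oo)%E ->
  (forall k, {ae mu, forall x, D x -> V k x <= g x}) ->
  (forall k, \int[mu]_(x in D) (W k x)%:E <= \int[mu]_(x in D) (V k x)%:E)%E ->
  ~ {ae mu, forall x, D x -> exists2 dlt, 0 < dlt &
       \forall k \near \oo, V k x + dlt <= W k x}.
Proof.
move=> mD D0 mV mW mg V0 W0 g0 gfin Vg WV gap.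
have int_ge0 (f : T -> R) : (forall x, 0 <= f x) ->
    (0 <= \int[mu]_(x in D) (f x)%:E)%E.
  by move=> f0; apply: integral_ge0 => x _; rewrite lee_fin.
have Vfin k : (\int[mu]_(x in D) (V k x)%:E < +oo)%E.
  apply: le_lt_trans gfin; apply: ae_ge0_le_integral => //.
  - by move=> x _; rewrite lee_fin.
  - exact/measurable_EFinP.
  - by move=> x _; rewrite lee_fin.
  - exact/measurable_EFinP.
  - by apply: filterS (Vg k) => x /[apply]; rewrite lee_fin.
(* Truncated because V k <= g only holds almost everywhere. *)
pose N k x := W k x + Num.max (g x - V k x) 0.
have N0 k x : 0 <= N k x by rewrite addr_ge0// le_max lexx orbT.
have mN k : measurable_fun D (N k).
  apply: measurable_funD => //; apply: measurable_maxr => //.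
  exact: measurable_funB.
have Ng k : (\int[mu]_(x in D) (N k x)%:E <= \int[mu]_(x in D) (g x)%:E)%E.
  have Vfn : (\int[mu]_(x in D) (V k x)%:E)%E \is a fin_num.
    by rewrite ge0_fin_numE// int_ge0.
  rewrite -(leeD2rE _ _ Vfn).
  rewrite -ge0_integralD//; last 4 first.
    - by move=> x _; rewrite lee_fin.
    - exact/measurable_EFinP.
    - by move=> x _; rewrite lee_fin.
    - exact/measurable_EFinP.
  rewrite (@ge0_ae_eq_integral _ _ _ mu D _ (fun x => (W k x)%:E + (g x)%:E)%E)//.
  - rewrite ge0_integralD//; last 4 first.
      - by move=> x _; rewrite lee_fin.
      - exact/measurable_EFinP.
      - by move=> x _; rewrite lee_fin.
      - exact/measurable_EFinP.
    by rewrite addeC leeD2l.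
  - by apply: emeasurable_funD; exact/measurable_EFinP.
  - by apply: emeasurable_funD; exact/measurable_EFinP.
  - by move=> x _; rewrite -EFinD lee_fin addr_ge0.
  - by move=> x _; rewrite -EFinD lee_fin addr_ge0.
  - apply: filterS (Vg k) => x /[apply] Vgx.
    by rewrite -!EFinD /N max_l ?subr_ge0// -addrA subrK.
pose F x := limn_einf (fun k => (N k x)%:E).
have mF : measurable_fun D F.
  rewrite /F /limn_einf; apply: measurableT_comp => //.
  apply: measurable_fun_limn_esup => k; apply/measurable_EFinP.
  exact: measurable_funN.
have F0 x : (0 <= F x)%E by apply: le_limn_einf; apply: nearW => k; rewrite lee_fin.
have intF : (\int[mu]_(x in D) F x <= \int[mu]_(x in D) (g x)%:E)%E.
  apply: (@le_trans _ _ (limn_einf (fun k => \int[mu]_(x in D) (N k x)%:E)))%E.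
    apply: fatou => //; first by move=> k; exact/measurable_EFinP.
    by move=> k x _; rewrite lee_fin.
  rewrite limn_einf_lim; apply: lime_le; first exact: is_cvg_einfs.
  apply: nearW => k; apply: le_trans (Ng k).
  by apply: ereal_inf_lbound; exists k => /=.
have Fg : {ae mu, forall x, D x -> ((g x)%:E < F x)%E}.
  apply: filterS gap => x /[apply] -[dlt dlt0 nd].
  apply: (@lt_le_trans _ _ (g x + dlt)%:E); first by rewrite lte_fin ltrDl.
  apply: le_limn_einf; apply: filterS nd => k Vk; rewrite lee_fin /N.
  have : g x - V k x <= Num.max (g x - V k x) 0 by rewrite le_max lexx.
  lra.
(* Since [g] has finite integral, it can be added to both sides: [G + g] equals [F] almost
   everywhere, so [G] has integral 0 and vanishes almost everywhere, against [g < F]. *)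
pose G x := maxe (F x - (g x)%:E)%E 0%E.
have mG : measurable_fun D G.
  apply: measurable_maxe => //; apply: emeasurable_funB => //.
  exact/measurable_EFinP.
have G0 x : (0 <= G x)%E by rewrite /G le_max lexx orbT.
have intG : (\int[mu]_(x in D) G x = 0)%E.
  apply/eqP; rewrite eq_le integral_ge0 ?andbT//.
  have gfn : (\int[mu]_(x in D) (g x)%:E)%E \is a fin_num.
    by rewrite ge0_fin_numE// int_ge0.
  rewrite -(leeD2rE _ _ gfn) add0e -ge0_integralD//; last 2 first.
    - by move=> x _; rewrite lee_fin.
    - exact/measurable_EFinP.
  rewrite (@ge0_ae_eq_integral _ _ _ mu D _ F)//.
  - by apply: emeasurable_funD => //; exact/measurable_EFinP.
  - by move=> x _; rewrite adde_ge0// lee_fin.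
  - apply: filterS Fg => x /[apply] Fgx.
    by rewrite /G max_l ?subeK// sube_ge0// ltW.
have /ae_eq_integral_abs : (\int[mu]_(x in D) `|G x| = 0)%E.
  by rewrite -[RHS]intG; apply: eq_integral => x _; rewrite gee0_abs.
move=> /(_ mD mG) Gae.
have : {ae mu, forall x, ~ D x}.
  near=> x => Dx.
  have Fgx : ((g x)%:E < F x)%E by move: Dx; near: x.
  have : G x = 0%E by move: Dx; near: x.
  rewrite /G max_l ?sube_ge0 ?ltW// => Gx0.
  by move: Fgx; rewrite -sube_gt0 Gx0 ltxx.
by move=> /(ae_false_measure0 mD) D00; rewrite D00 ltxx in D0.
Unshelve. all: by end_near. Qed.

(** The bounds add up to 1, so the sum of the series of the [f k] is integrable, hence finite almost
    everywhere, and the terms of a convergent series tend to 0. *)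
Lemma ae_cvg0_of_summable_integrals d (T : measurableType d) (R : realType)
    (mu : {measure set T -> \bar R}) (D : set T) (f : nat -> T -> R) :
  measurable D -> (forall k, measurable_fun D (f k)) -> (forall k x, 0 <= f k x) ->
  (forall k, \int[mu]_(x in D) (f k x)%:E <= (1 / (2 ^ k.+1)%:R)%:E)%E ->
  {ae mu, forall x, D x -> f k x @[k --> \oo] --> 0}.
Proof.
move=> mD mf f0 intf.
pose S x := (\sum_(k <oo) (f k x)%:E)%E.
have mS : measurable_fun D S.
  apply: ge0_emeasurable_sum => [k x _ _|k _]; first by rewrite lee_fin.
  exact/measurable_EFinP.
have S0 x : (0 <= S x)%E by apply: nneseries_ge0 => k _ _; rewrite lee_fin.
have intS : (\int[mu]_(x in D) S x <= 1%:E)%E.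
  rewrite integral_nneseries//; last 2 first.
    - by move=> k; exact/measurable_EFinP.
    - by move=> k x _; rewrite lee_fin.
  apply: le_trans (epsilon_trick0 xpredT ler01).
  apply: lee_nneseries => [k _ _|k _]; last exact: intf.
  by apply: integral_ge0 => x _; rewrite lee_fin.
have iS : mu.-integrable D S.
  apply/integrableP; split => //; apply: le_lt_trans (ltry 1).
  by apply: le_trans intS; apply: ge0_le_integral => //; [exact: measurableT_comp|
    move=> x _; rewrite gee0_abs].
apply: filterS (integrable_ae mD iS) => x /[apply] Sfin.
apply: cvg_series_cvg_0; apply: nondecreasing_is_cvgn.
  by apply: nondecreasing_series => k _ _.
exists (fine (S x)) => _ [k _ <-].
rewrite -lee_fin fineK// /series/= -sumEFin.
by apply: nneseries_lim_ge => j _ _; rewrite lee_fin.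
Qed.

(** * Measurability of the rates *)

Section rates_measurable.
Context d (T : measurableType d) (R : realType).
Variables (p q : R -> R) (D : set T).
Hypothesis p0 : p 0 = 0.
Hypothesis pq_lt : forall s t, 0 <= s -> s < t -> p s < q t.
Hypothesis qp_le : forall t, 0 <= t -> q t <= p t.

Lemma measurable_pos_indic (f : T -> R) :
  measurable_fun D f -> measurable_fun D (fun x => (0 < f x)%R%:R : R).
Proof.
have mpos : measurable_fun [set: R] (fun t : R => (0 < t)%R%:R : R).
  apply: nondecreasing_measurable => // s t st.
  by case: (ltP 0 s) => // s0; rewrite (lt_le_trans s0 st).
exact: measurableT_comp mpos.
Qed.

Lemma measurable_p_norm (f : T -> R) :
  measurable_fun D f -> measurable_fun D (fun x => p `|f x|).
Proof.
move=> mf.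
pose p' t := p (Num.max 0 t).
have mp' : measurable_fun [set: R] p'.
  apply: nondecreasing_measurable => // s t st.
  apply: (p_nondecreasing pq_lt qp_le); first by rewrite le_max lexx.
  by rewrite ge_max !le_max lexx st orbT.
rewrite (_ : (fun _ => _) = p' \o (fun x => `|f x|)); last first.
  by apply/funext => x; rewrite /p' /= max_r.
by apply: measurableT_comp mp' _; exact: measurableT_comp.
Qed.

Lemma measurable_rise_rate (f g : T -> R) :
  measurable_fun D f -> measurable_fun D g ->
  measurable_fun D (fun x => rise_rate p (f x) (g x)).
Proof.
move=> mf mg.
rewrite (_ : (fun _ => _) =
    (fun x => (p `|f x| * `|g x|) * (0 < - (f x * g x))%R%:R)); last first.
  apply/funext => x; rewrite /rise_rate oppr_gt0.
  by case: ifPn; rewrite ?mulr1 ?mulr0.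
apply: measurable_funM.
  apply: measurable_funM; first exact: measurable_p_norm.
  exact: measurableT_comp.
apply: measurable_pos_indic; apply: measurable_funN; exact: measurable_funM.
Qed.

Lemma measurable_drop_rate (f g : T -> R) :
  measurable_fun D f -> measurable_fun D g ->
  measurable_fun D (fun x => drop_rate q (f x) (g x)).
Proof.
move=> mf mg.
(* Cutting [q] off outside the positive numbers gives a function monotone on the whole line; the
   value at 0 is harmless, because [drop_rate] vanishes there. *)
pose q' t := if 0 < t then q t else 0.
have mq' : measurable_fun [set: R] q'.
  apply: nondecreasing_measurable => // s t st; rewrite /q'.
  case: (ltP 0 s) => s0.
    rewrite (lt_le_trans s0 st); exact: (q_nondecreasing pq_lt qp_le s0 st).
  by case: ifPn => // /(q_gt0 p0 pq_lt)/ltW.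
rewrite (_ : (fun _ => _) =
    (fun x => (q' `|f x| * `|g x|) * (0 < f x * g x)%R%:R)); last first.
  apply/funext => x; rewrite /drop_rate.
  case: ifPn => [fg|_]; last by rewrite mulr0.
  rewrite mulr1 /q' normr_gt0 ifT//.
  by apply: contraTneq fg => ->; rewrite mul0r ltxx.
apply: measurable_funM.
  apply: measurable_funM; last exact: measurableT_comp.
  by apply: (measurableT_comp mq'); exact: measurableT_comp.
apply: measurable_pos_indic; exact: measurable_funM.
Qed.

End rates_measurable.

(** * Incompatibility of the two optimality conditions *)

Section directional_gap.
Context d (T : measurableType d) (R : realType).
Variables (mu : {measure set T -> \bar R}) (p q : R -> R) (D : set T).
Hypothesis p0 : p 0 = 0.
Hypothesis pq_lt : forall s t, 0 <= s -> s < t -> p s < q t.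
Hypothesis qp_le : forall t, 0 <= t -> q t <= p t.
Variable C : R.
Hypothesis C_ge0 : 0 <= C.
Hypothesis p_doubling : forall s, 0 <= s -> p (2 * s) <= C * p s.
Hypotheses (mD : measurable D) (D_gt0 : (0 < mu D)%E) (D_fin : (mu D < +oo)%E).

(** A substitute for subadditivity, from s + t <= 2 max(s, t); it keeps [p] of a function integrable
    when a bounded function is added to the latter. *)
Lemma p_add_le s t : 0 <= s -> 0 <= t -> p (s + t) <= C * (p s + p t).
Proof.
have pnd := p_nondecreasing pq_lt qp_le.
have pge0 := p_ge0 p0 pq_lt qp_le.
wlog st : s t / s <= t.
  move=> wl s0 t0; have [st|/ltW ts] := leP s t; first exact: wl.
  by rewrite addrC [X in C * X]addrC; exact: wl.
move=> s0 t0; apply: le_trans (_ : p (2 * t) <= _).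
  by apply: pnd; [rewrite addr_ge0|lra].
apply: le_trans (p_doubling t0) _.
by rewrite ler_wpM2l// lerDr pge0.
Qed.

Lemma no_common_descent (h H P : T -> R) (h_ e_ : nat -> T -> R) (e : T -> R) (K : R) :
  measurable_fun D h -> measurable_fun D H -> measurable_fun D P ->
  (forall k, measurable_fun D (h_ k)) -> (forall k, measurable_fun D (e_ k)) ->
  (\int[mu]_(x in D) (p `|h x|)%:E < +oo)%E ->
  (\int[mu]_(x in D) (p `|H x|)%:E < +oo)%E ->
  (forall k, {ae mu, forall x, D x -> `|h_ k x| <= H x}) ->
  (forall k, \int[mu]_(x in D) (p `|h_ k x - h x|)%:E <= (1 / (2 ^ k.+1)%:R)%:E)%E ->
  0 <= K -> (forall x, D x -> `|P x| <= K) ->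
  (forall k x, D x -> `|e_ k x| <= K) ->
  (forall x, D x -> e_ k x @[k --> \oo] --> e x) ->
  {ae mu, forall x, D x -> e x != 0} ->
  (forall k, \int[mu]_(x in D) (drop_rate q (h x - P x) (e_ k x))%:E <=
     \int[mu]_(x in D) (rise_rate p (h x - P x) (e_ k x))%:E)%E ->
  (forall k,
     \int[mu]_(x in D) (drop_rate q (h_ k x - P x - e_ k x) (- e_ k x))%:E <=
     \int[mu]_(x in D) (rise_rate p (h_ k x - P x - e_ k x) (- e_ k x))%:E)%E ->
  False.
Proof.
move=> mh mH mP mh_ me_ ih iH h_H h_h K0 PK eK e_e e0 min_h min_h_.
have pnd := p_nondecreasing pq_lt qp_le.
have pge0 := p_ge0 p0 pq_lt qp_le.
pose V k x := rise_rate p (h x - P x) (e_ k x) +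
  rise_rate p (h_ k x - P x - e_ k x) (- e_ k x).
pose W k x := drop_rate q (h x - P x) (e_ k x) +
  drop_rate q (h_ k x - P x - e_ k x) (- e_ k x).
(* The majorant of [V k]: directions are at most [K], the residual of [h] is at most [|h| + K], and
   that of [h_ k], shifted by both [P] and [e_ k], at most [|H| + (K + K)]. *)
pose g x := K * (C * (p `|h x| + p K)) + K * (C * (p `|H x| + p (K + K))).
have KK : 0 <= K + K by rewrite addr_ge0.
have mr1 k : measurable_fun D (fun x => rise_rate p (h x - P x) (e_ k x)).
  by apply: (measurable_rise_rate pq_lt qp_le) => //; exact: measurable_funB.
have md1 k : measurable_fun D (fun x => drop_rate q (h x - P x) (e_ k x)).
  by apply: (measurable_drop_rate p0 pq_lt qp_le) => //; exact: measurable_funB.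
have mr2 k : measurable_fun D
    (fun x => rise_rate p (h_ k x - P x - e_ k x) (- e_ k x)).
  apply: (measurable_rise_rate pq_lt qp_le) => //; last exact: measurable_funN.
  by apply: measurable_funB => //; exact: measurable_funB.
have md2 k : measurable_fun D
    (fun x => drop_rate q (h_ k x - P x - e_ k x) (- e_ k x)).
  apply: (measurable_drop_rate p0 pq_lt qp_le) => //; last exact: measurable_funN.
  by apply: measurable_funB => //; exact: measurable_funB.
have r_ge0 u c := rise_rate_ge0 p0 pq_lt qp_le u c.
have d_ge0 u c := drop_rate_ge0 p0 pq_lt u c.
have intD (f f' : T -> R) : measurable_fun D f -> measurable_fun D f' ->
    (forall x, 0 <= f x) -> (forall x, 0 <= f' x) ->
    (\int[mu]_(x in D) (f x + f' x)%:E =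
     \int[mu]_(x in D) (f x)%:E + \int[mu]_(x in D) (f' x)%:E)%E.
  move=> mf mf' f0 f'0; under eq_integral do rewrite EFinD.
  rewrite ge0_integralD//.
  - by move=> x _; rewrite lee_fin.
  - exact/measurable_EFinP.
  - by move=> x _; rewrite lee_fin.
  - exact/measurable_EFinP.
have g_part (f : T -> R) (c : R) : 0 <= c -> measurable_fun D f ->
    (\int[mu]_(x in D) (p `|f x|)%:E < +oo)%E ->
    measurable_fun D (fun x => K * (C * (p `|f x| + p c))) /\
    (\int[mu]_(x in D) (K * (C * (p `|f x| + p c)))%:E < +oo)%E.
  move=> c0 mf intf.
  have mpf : measurable_fun D (fun x => p `|f x| + p c).
    by apply: measurable_funD => //; exact: (measurable_p_norm pq_lt qp_le).
  split; first by apply: measurable_funM => //; exact: measurable_funM.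
  under eq_integral do rewrite mulrA EFinM.
  rewrite ge0_integralZl_EFin//; last 3 first.
    - by move=> x _; rewrite lee_fin addr_ge0 ?pge0.
    - exact/measurable_EFinP.
    - exact: mulr_ge0.
  rewrite lte_mul_pinfty// ?lee_fin ?mulr_ge0//.
  rewrite intD//.
  - rewrite lte_add_pinfty// integral_cst// lte_mul_pinfty// lee_fin; exact: pge0.
  - exact: (measurable_p_norm pq_lt qp_le).
  - by move=> x; exact: pge0.
  - by move=> x; exact: pge0.
have [mg1 ig1] := g_part h K K0 mh ih.
have [mg2 ig2] := g_part H (K + K) KK mH iH.
have gp_ge0 (f : T -> R) (c : R) x : 0 <= c -> 0 <= K * (C * (p `|f x| + p c)).
  by move=> c0; rewrite mulr_ge0// mulr_ge0// addr_ge0// pge0.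
apply: (@fatou_gap _ _ _ mu D V W g) => //.
- by move=> k; exact: measurable_funD.
- by move=> k; exact: measurable_funD.
- exact: measurable_funD.
- by move=> k x; rewrite addr_ge0.
- by move=> k x; rewrite addr_ge0.
- by move=> x; rewrite addr_ge0// gp_ge0.
- rewrite intD//; first exact: lte_add_pinfty.
  + by move=> x; exact: gp_ge0.
  + by move=> x; exact: gp_ge0.
- move=> k; apply: filterS (h_H k) => x h_Hx Dx.
  have {}h_Hx := h_Hx Dx; rewrite /V /g lerD//.
  + apply: le_trans (rise_rate_le p0 pq_lt qp_le _ _) _.
    rewrite mulrC ler_pM ?pge0 ?eK//.
    apply: le_trans (p_add_le _ _) => //; apply: pnd => //.
    by rewrite (le_trans (ler_normB _ _))// lerD2l PK.
  + apply: le_trans (rise_rate_le p0 pq_lt qp_le _ _) _.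
    rewrite normrN mulrC ler_pM ?pge0 ?eK//.
    apply: le_trans (p_add_le _ _) => //; apply: pnd => //.
    rewrite -addrA -opprD (le_trans (ler_normB _ _))// lerD//.
      by rewrite (le_trans h_Hx)// ler_norm.
    by rewrite (le_trans (ler_normD _ _))// lerD// ?PK ?eK.
- by move=> k; rewrite /W /V !intD// leeD.
- have mdiff k : measurable_fun D (fun x => p `|h_ k x - h x|).
    by apply: (measurable_p_norm pq_lt qp_le); exact: measurable_funB.
  have pd_ge0 k x : 0 <= p `|h_ k x - h x| by exact: pge0.
  have := ae_cvg0_of_summable_integrals mD mdiff pd_ge0 h_h.
  move=> pcvg; near=> x => Dx.
  have ex0 : e x != 0 by move: Dx; near: x.
  have px : p `|h_ k x - h x| @[k --> \oo] --> 0 by move: Dx; near: x.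
  (* A distance of at least [eps] would force the value of [p] to be at least [p eps > 0]. *)
  have hx : h_ k x @[k --> \oo] --> h x.
    apply/cvgrPdist_lt => eps eps0.
    have peps : 0 < p eps := p_gt0 p0 pq_lt qp_le eps0.
    apply: filterS (cvgr_lt _ px _ peps) => k pk.
    rewrite ltNge; apply/negP => epsk; move: pk; rewrite ltNge => /negP; apply.
    by rewrite distrC; apply: pnd => //; exact: ltW.
  apply: (rates_gap p0 pq_lt qp_le ex0 (e_e _ Dx)).
  by apply: cvgB; [apply: cvgB => //; exact: cvg_cst|exact: e_e].
Unshelve. all: by end_near. Qed.

(** With [u = f - P], this transports optimality in the direction [- e] from [P + s e] back to
    [P + e], by integrating the two pointwise comparisons along the segment. *)
Lemma integral_rates_segment (u e : T -> R) (s : R) :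
  measurable_fun D u -> measurable_fun D e -> 1 <= s ->
  (\int[mu]_(x in D) (drop_rate q (u x - s * e x) (- e x))%:E <=
   \int[mu]_(x in D) (rise_rate p (u x - s * e x) (- e x))%:E)%E ->
  (\int[mu]_(x in D) (drop_rate q (u x - e x) (- e x))%:E <=
   \int[mu]_(x in D) (rise_rate p (u x - e x) (- e x))%:E)%E.
Proof.
move=> mu_ me s1.
have mse : measurable_fun D (fun x => s * e x) by exact: measurable_funM.
have mNe : measurable_fun D (fun x => - e x) by exact: measurable_funN.
have r_ge0 v c := rise_rate_ge0 p0 pq_lt qp_le v c.
have d_ge0 v c := drop_rate_ge0 p0 pq_lt v c.
have md (v : T -> R) : measurable_fun D v ->
    measurable_fun D (fun x => (drop_rate q (v x) (- e x))%:E).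
  move=> mv; apply/measurable_EFinP.
  exact: (measurable_drop_rate p0 pq_lt qp_le mv mNe).
have mr (v : T -> R) : measurable_fun D v ->
    measurable_fun D (fun x => (rise_rate p (v x) (- e x))%:E).
  by move=> mv; apply/measurable_EFinP; exact: (measurable_rise_rate pq_lt qp_le mv mNe).
move=> hle; apply: le_trans (le_trans _ hle) _; apply: ge0_le_integral => //.
- by move=> x _; rewrite lee_fin.
- by apply: (md (fun x => _)); exact: measurable_funB.
- by apply: (md (fun x => _)); exact: measurable_funB.
- by move=> x _; rewrite lee_fin; exact: (drop_rate_segment p0 pq_lt qp_le).
- by move=> x _; rewrite lee_fin.
- by apply: (mr (fun x => _)); exact: measurable_funB.
- by apply: (mr (fun x => _)); exact: measurable_funB.
- by move=> x _; rewrite lee_fin; exact: (rise_rate_segment p0 pq_lt qp_le).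
Qed.

End directional_gap.

(** * Polynomials on R^n *)

Lemma measurable_meval_borel (R : realType) n (P : mpoly n R) :
  measurable_fun [set: borel_Rn R n] (fun x : borel_Rn R n => meval (tnth x) P : R).
Proof.
under eq_fun do rewrite mevalE.
apply: measurable_sum => m; apply: measurable_funM => //.
apply: measurable_prod => i _; apply: measurable_funX.
exact: (@measurable_tnth _ (measurableTypeR R)).
Qed.

Lemma measurable_meval_eq0 (R : realType) n (P : mpoly n R) :
  measurable [set x : borel_Rn R n | meval (tnth x) P = 0].
Proof.
have := measurable_meval_borel P measurableT (measurable_set1 (0 : R)).
by rewrite setTI.
Qed.

Lemma msupp_has (R : realType) n (P : mpoly n R) : P != 0 ->
  exists m, m \in msupp P.
Proof.
move=> P0; case E : (msupp P) (msupp_eq0 P) => [|m s].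
  by rewrite (negbTE P0).
by exists m; rewrite mem_head.
Qed.

Definition multinom_tail n (m : multinom n.+1) : multinom n :=
  Multinom [tuple m (lift ord0 i) | i < n].

(** [P] with its first variable frozen at [t]. Distinct monomials of [P] may share a tail, so for
    special [t] the section can vanish although [P] does not. *)
Definition mpoly_section (R : realType) n (P : mpoly n.+1 R) (t : R) : mpoly n R :=
  \sum_(m <- msupp P) (mcoeff m P * t ^+ m ord0) *: mpolyX R (multinom_tail m).

Lemma meval_mpoly_section (R : realType) n (P : mpoly n.+1 R) (t : R)
    (y : n.-tuple R) :
  meval (tnth y) (mpoly_section P t) = meval (tnth [tuple of t :: y]) P.
Proof.
rewrite [RHS]mevalE /mpoly_section raddf_sum/=; apply: eq_bigr => m _.
rewrite mevalZ mevalX -mulrA big_ord_recl; congr (_ * (_ * _)).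
by apply: eq_bigr => i _; rewrite mnmE tnthS.
Qed.

(* The values t excluded are the roots of the polynomial in the first variable
   that is the coefficient of a monomial of P in the other variables. *)
Lemma mpoly_section_neq0 (R : realType) n (P : mpoly n.+1 R) : P != 0 ->
  exists2 r : {poly R}, r != 0 & forall t, ~~ root r t -> mpoly_section P t != 0.
Proof.
move=> P0; have [m0 m0P] := msupp_has P0.
pose r : {poly R} := \sum_(m <- msupp P)
  (mcoeff m P * (multinom_tail m == multinom_tail m0)%:R) *: 'X^(m ord0).
exists r.
  apply: contraTneq m0P => r0; rewrite mcoeff_msupp negbK.
  have : r`_(m0 ord0) = 0 by rewrite r0 coef0.
  rewrite /r coef_sum; under eq_bigr do rewrite coefZ coefXn.
  case: (boolP (m0 \in msupp P)) => [m0P|]; last by rewrite mcoeff_msupp negbK.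
  (* A monomial is determined by its first exponent and its tail, so only [m0] contributes to this
     coefficient of [r]. *)
  rewrite (bigD1_seq m0) ?msupp_uniq//= !eqxx !mulr1 big1 ?addr0 => [/eqP//|m mm0].
  have [tl|] := eqVneq (multinom_tail m) _; last by rewrite mulr0 mul0r.
  have [hd|] := eqVneq (m0 ord0) _; last by rewrite mulr0.
  case/eqP: mm0; apply/mnmP => i; case: (unliftP ord0 i) => [j ->|->]//.
  by have := congr1 (fun m : multinom n => m j) tl; rewrite !mnmE.
move=> t; apply: contraNneq => st0; rewrite /root.
suff -> : r.[t] = mcoeff (multinom_tail m0) (mpoly_section P t).
  by rewrite st0 mcoeff0.
rewrite /mpoly_section raddf_sum/= /r horner_sum; apply: eq_bigr => m _.
by rewrite hornerZ hornerXn mcoeffZ mcoeffX mulrAC.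
Qed.

Lemma finite_roots (R : realType) (r : {poly R}) : r != 0 ->
  finite_set [set t : R | root r t].
Proof.
move=> r0; apply: contrapT => /(@infinite_set_fset _ _ (size r))[B Br sB].
have rB : all (root r) (finmap.enum_fset B) by apply/allP => t tB; exact: Br.
by have := max_poly_roots r0 rB (finmap.fset_uniq B); rewrite ltnNge sB.
Qed.

(** Induction with the product measure: for all but finitely many values of the first variable the
    section is a nonzero polynomial, so the slice of the zero set is null. For [n = 0] a nonzero
    constant has no zero. *)
Lemma borel_lebesgue_meval_eq0 (R : realType) n (P : mpoly n R) : P != 0 ->
  @borel_lebesgue R n [set x : borel_Rn R n | meval (tnth x) P = 0] = 0%E.
Proof.
elim: n P => [|n IH] P P0.
  have [m0 m0P] := msupp_has P0.
  rewrite /= (_ : [set _ | _] = set0) ?measure0//.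
  apply/seteqP; split => // x /=; rewrite mevalE.
  rewrite (bigD1_seq m0) ?msupp_uniq//= big_ord0 mulr1 big1 ?addr0 => [/eqP|m mm0].
    by rewrite mcoeff_eq0 m0P.
  by case/eqP: mm0; apply/mnmP => -[].
have [r r0 rP] := mpoly_section_neq0 P0.
rewrite /= /pushforward; set A := _ @^-1` _.
have mA : measurable A.
  rewrite -[A]setTI; apply: measurable_cons_Rn => //; exact: measurable_meval_eq0.
rewrite /product_measure1 (@ae_eq_integral _ _ _ _ _ (cst 0%E)) ?integral0//.
  exact: measurable_fun_xsection.
have root0 : lebesgue_measure [set t : R | root r t] = 0%E.
  apply: countable_lebesgue_measure0; apply: finite_set_countable.
  exact: finite_roots.
exists [set t : R | root r t]; split => //.
  exact/countable_measurable/finite_set_countable/finite_roots.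
move=> t /=; apply: contraPP => /negP rt; apply; move=> _.
rewrite -(IH _ (rP _ rt)); congr (@borel_lebesgue _ _ _).
by apply/seteqP; split => y; rewrite /xsection/= /A/= inE/= meval_mpoly_section.
Qed.

Lemma measurable_Rn_borel (R : realType) n (A : set (borel_Rn R n)) :
  measurable A -> @measurable _ (Rn R n) A.
Proof.
move=> mA; have gA : <<s @measurable _ (borel_Rn R n) >> A by exact: sub_sigma_algebra.
exact: (@sub_caratheodory _ (borel_Rn R n) R (@borel_lebesgue R n) _ gA).
Qed.

Section bounded_Rn_theory.
Variables (R : realType) (n : nat).

Lemma measurable_poly_fun (P : mpoly n R) (D : set (Rn R n)) :
  measurable_fun D (poly_fun P).
Proof.
move=> mD Y mY; apply: measurableI => //.
apply: measurable_Rn_borel.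
by have := measurable_meval_borel P measurableT mY; rewrite setTI.
Qed.

Lemma lebesgue_Rn_borel (A : set (borel_Rn R n)) : measurable A ->
  @lebesgue_Rn R n A = borel_lebesgue A.
Proof.
by move=> mA; rewrite /lebesgue_Rn /completed_measure_extension measurable_mu_extE.
Qed.

Lemma poly_fun_neq0_ae (P : mpoly n R) : P != 0 ->
  {ae @lebesgue_Rn R n, forall x, poly_fun P x != 0}.
Proof.
move=> P0; exists [set x | poly_fun P x = 0]; split.
- have := @measurable_poly_fun P setT measurableT [set 0] (measurable_set1 (0 : R)).
  by rewrite setTI.
- transitivity (@borel_lebesgue R n [set x : borel_Rn R n | meval (tnth x) P = 0]).
    exact: (lebesgue_Rn_borel (measurable_meval_eq0 P)).
  exact: borel_lebesgue_meval_eq0.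
- by move=> x /= /negP; rewrite negbK => /eqP.
Qed.

End bounded_Rn_theory.

(** A cube is a product of intervals of finite length. This gives [Omega] finite measure, which
    makes constants integrable. *)
Lemma borel_box (R : realType) (M : R) n :
  measurable [set x : borel_Rn R n | forall i, `|tnth x i| <= M] /\
  (@borel_lebesgue R n [set x : borel_Rn R n | forall i, (`|tnth x i| <= M)%R] < +oo)%E.
Proof.
elim: n => [|n [mB finB]].
  rewrite (_ : [set _ | _] = setT); first by split => //=; rewrite diracT ltry.
  by apply/seteqP; split => // x _ [].
set B := [set _ | _] in mB finB; set B' := [set _ | _].
have B'E : B' = @uncons_Rn R n @^-1` (`[- M, M]%classic `*` B).
  apply/seteqP; split => x /=.
    move=> xM; split; first by rewrite in_itv/= -ler_norml; exact: xM.
    by move=> i; rewrite tnth_behead; exact: xM.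
  rewrite in_itv/= -ler_norml => -[x0 xM] i.
  case: (unliftP ord0 i) => [j ->|-> //].
  have := xM j; rewrite tnth_behead.
  by rewrite (_ : inord _ = lift ord0 j)//; apply/val_inj; rewrite /= inordK// ltnS.
have mI : measurable (`[- M, M]%classic : set (measurableTypeR R)) by [].
split.
  rewrite B'E -[X in measurable X]setTI; apply: measurable_uncons_Rn => //.
  exact: measurableX.
rewrite B'E /= /pushforward -comp_preimage (_ : _ \o _ = id); last first.
  by apply/funext => -[x y]; congr pair; exact/val_inj.
rewrite preimage_id product_measure1E//.
apply: lte_mul_pinfty => //; rewrite /= lebesgue_measure_itv/=.
by case: ifP.
Qed.

Lemma bounded_Rn_finite (R : realType) n (A : set (Rn R n)) :
  measurable A -> bounded_Rn A -> (@lebesgue_Rn R n A < +oo)%E.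
Proof.
move=> mA [M AM]; have [mB finB] := borel_box M n.
apply: le_lt_trans finB; rewrite -lebesgue_Rn_borel//.
apply: le_measure; rewrite ?inE//.
exact: measurable_Rn_borel.
Qed.

Lemma poly_fun_bounded (R : realType) n (A : set (Rn R n)) (P : mpoly n R) :
  bounded_Rn A -> exists2 K, 0 <= K & forall x, A x -> `|poly_fun P x| <= K.
Proof.
move=> [M AM]; exists (\sum_(m <- msupp P) `|mcoeff m P| * \prod_(i < n) `|M| ^+ m i).
  by apply: sumr_ge0 => m _; rewrite mulr_ge0// prodr_ge0// => i _; rewrite exprn_ge0.
move=> x Ax; rewrite /poly_fun mevalE; apply: le_trans (ler_norm_sum _ _ _) _.
apply: ler_sum => m _; rewrite normrM ler_wpM2l// normr_prod.
apply: ler_prod => i _; rewrite normr_ge0 normrX/= lerXn2r ?nnegrE//.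
by rewrite (le_trans (AM x Ax i))// ler_norm.
Qed.

(** * Compactness and coordinates *)

(** Terms of [D] that stay away from 0 are projected radially onto a sphere of radius [eps], whose
    compactness yields a nonzero limit direction. The bound on [a] is imposed by the same choice of
    indices and provides summability. *)
Lemma sphere_extraction (R : realType) N (D : nat -> 'rV[R]_N) (a : (\bar R)^nat) :
  a @ \oo --> 0%E -> ~ (D @ \oo --> (0 : 'rV[R]_N)) ->
  exists (eps : R) (v : 'rV[R]_N) (E : nat -> 'rV[R]_N) (s : nat -> R) (i : nat -> nat),
  [/\ 0 <= eps, v != 0, E @ \oo --> v &
    forall j, [/\ 1 <= s j, D (i j) = s j *: E j, `|E j| <= eps &
      (a (i j) <= (1 / (2 ^ j.+1)%:R)%:E)%E]].
Proof.
move=> a0 D0.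
have [eps eps0 Deps] : exists2 eps : R, 0 < eps &
    forall n, exists2 k, (n <= k)%N & eps <= `|D k|.
  apply: contrapT => noeps; apply: D0; apply/cvgrPdist_lt => eps eps0.
  have [n nD] : exists n, forall k, (n <= k)%N -> `|D k| < eps.
    apply: contrapT => non; apply: noeps; exists eps => // n.
    apply: contrapT => nok; apply: non; exists n => k nk.
    by rewrite ltNge; apply/negP => Dk; apply: nok; exists k.
  by exists n => // k /= nk; rewrite sub0r normrN nD.
have [kap kapP] : {kap : nat -> nat &
    forall n, (n <= kap n)%N /\ eps <= `|D (kap n)|}.
  by apply: (@choice _ _ (fun n k => (n <= k)%N /\ eps <= `|D k|)) => n;
    have [k] := Deps n; exists k.
pose s k := `|D (kap k)| / eps.
pose E k := (s k)^-1 *: D (kap k).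
have s1 k : 1 <= s k by rewrite /s ler_pdivlMr// mul1r (kapP k).2.
have DE k : D (kap k) = s k *: E k.
  by rewrite /E scalerA divff ?scale1r// gt_eqF// (lt_le_trans ltr01).
have nE k : `|E k| = eps.
  have Dk0 : 0 < `|D (kap k)| by apply: lt_le_trans (kapP k).2.
  rewrite /E normrZ ger0_norm ?invr_ge0 ?(le_trans ler01)//.
  by rewrite /s invf_div divfK// gt_eqF.
pose S := [set v : 'rV[R]_N | `|v| = eps].
have cS : compact S.
  apply: bounded_closed_compact.
    by exists eps; split => [|M epsM v /= ->]; [exact: gtr0_real|exact: ltW].
  apply: (@closed_comp _ _ (fun v : 'rV[R]_N => `|v|) [set eps]).
    by move=> v _; exact: norm_continuous.
  exact: closed_eq.
have [v [Sv clv]] : S `&` cluster (E @ \oo) !=set0.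
  by apply: cS; exists 0 => // k _; exact: nE.
have v0 : v != 0 by rewrite -normr_gt0 Sv.
(* Each index is chosen on its own, beyond the rank where [a] is small, using [n <= kap n]. The
   indices need not increase: the explicit rates in [j] already give convergence. *)
have [k kP] : {k : nat -> nat & forall j,
    `|v - E (k j)| < j.+1%:R^-1 /\ (a (kap (k j)) <= (1 / (2 ^ j.+1)%:R)%:E)%E}.
  apply: (@choice _ _ (fun j k => `|v - E k| < j.+1%:R^-1 /\
    (a (kap k) <= (1 / (2 ^ j.+1)%:R)%:E)%E)) => j.
  have [n _ an] : \forall n \near \oo, (a n <= (1 / (2 ^ j.+1)%:R)%:E)%E.
    have /fine_cvgP[afin /cvgr_lt] := a0.
    have c0 : 0 < 1 / (2 ^ j.+1)%:R :> R by rewrite divr_gt0// ltr0n expn_gt0.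
    move=> /(_ _ c0) alt; near=> n.
    have an : a n \is a fin_num by near: n.
    by rewrite -(fineK an) lee_fin ltW//; near: n.
  have j0 : 0 < (j.+1%:R^-1 : R) by rewrite invr_gt0.
  have [] := clv [set E k | k in [set k | (n <= k)%N]] [set w | `|v - w| < j.+1%:R^-1].
  - by exists n => // k /= nk; exists k.
  - by apply/nbhs_ballP; exists j.+1%:R^-1 => //= w; rewrite -ball_normE.
  - move=> _ [[k /= nk <-] Ek]; exists k; split => //.
    by apply: an; rewrite /= (leq_trans nk)//; exact: (kapP k).1.
exists eps, v, (E \o k), (s \o k), (kap \o k); split => //; first exact: ltW.
  apply/cvgrPdist_lt => eps' eps'0; near=> j.
  apply: lt_trans (kP j).1 _; near: j.
  have := near_infty_natSinv_lt (PosNum eps'0); exact.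
by move=> j; split; [exact: s1|exact: DE|rewrite /= nE|exact: (kP j).2].
Unshelve. all: by end_near. Qed.

(** The two sets are where [u] and [c] have the same strict sign, which is exactly where [drop_rate]
    is given by the product; elsewhere it is 0. *)
Lemma integral_drop_rate_split d (T : measurableType d) (R : realType)
    (mu : {measure set T -> \bar R}) (D : set T) (q : R -> R) (u c : T -> R) :
  measurable D -> measurable_fun D u -> measurable_fun D c ->
  measurable_fun D (fun x => drop_rate q (u x) (c x)) ->
  (forall x, D x -> 0 <= drop_rate q (u x) (c x)) ->
  (\int[mu]_(x in D `&` [set x | (0 < u x /\ 0 < c x)%R]) (q `|u x| * `|c x|)%:E +
   \int[mu]_(x in D `&` [set x | (u x < 0 /\ c x < 0)%R]) (q `|u x| * `|c x|)%:E =
   \int[mu]_(x in D) (drop_rate q (u x) (c x))%:E)%E.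
Proof.
move=> mD mu_ mc mr r0.
have quadrant (f g : T -> R) : measurable_fun D f -> measurable_fun D g ->
    measurable (D `&` [set x | 0 < f x /\ 0 < g x]).
  move=> mf mg; rewrite (_ : _ `&` _ =
    (D `&` f @^-1` `]0, +oo[) `&` (D `&` g @^-1` `]0, +oo[)).
    by apply: measurableI; [exact: mf|exact: mg].
  apply/seteqP; split => x /=; rewrite !in_itv/= !andbT.
    by move=> [Dx []].
  by move=> [[Dx ?] []].
set A := D `&` _; set B := D `&` _.
have mA : measurable A by exact: quadrant.
have mB : measurable B.
  have := quadrant (\- u) (\- c) (measurable_funN mu_) (measurable_funN mc).
  by congr measurable; apply/seteqP; split => x; rewrite /= ?oppr_gt0.
transitivity (\int[mu]_(x in A) (drop_rate q (u x) (c x))%:E +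
   \int[mu]_(x in B) (drop_rate q (u x) (c x))%:E)%E.
  congr (_ + _)%E; apply: eq_integral => x; rewrite inE => -[_ /= [ux cx]].
    by rewrite /drop_rate mulr_gt0.
  by rewrite /drop_rate nmulr_rgt0// cx.
have AB : A `|` B `<=` D by move=> x [[]|[]].
rewrite -ge0_integral_setU//=.
- rewrite integral_mkcond [RHS]integral_mkcond; apply: eq_integral => x _.
  rewrite !patchE; case: ifPn => [|xAB].
    by rewrite inE => /AB Dx; rewrite mem_set.
  case: ifPn => // xD; rewrite /drop_rate; case: ifPn => // ucx.
  move: xAB; rewrite notin_setE => /not_orP[nA nB].
  have [u0|u0|u0] := ltgtP (u x) 0.
  + by case: nB; split; [exact: set_mem|split => //; move: ucx; rewrite nmulr_rgt0].
  + by case: nA; split; [exact: set_mem|split => //; move: ucx; rewrite pmulr_rgt0].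
  + by move: ucx; rewrite u0 mul0r ltxx.
- by apply/measurable_EFinP; exact: measurable_funS mr.
- by move=> x /AB Dx; rewrite lee_fin r0.
- rewrite disj_set2E; apply/eqP/seteqP; split => x //= [[_ [ux _]] [_ [ux' _]]].
  by move: (lt_trans ux ux'); rewrite ltxx.
Qed.

(** * Coordinates in the basis of monomials *)

Section mpoly_coordinates.
Variables (R : realType) (n m : nat).
Local Notation N := #|{: bmultinom n m.+1}|.

(** The index type consists of the monomials of degree strictly below [m.+1], hence at most [m]. *)
Definition mpoly_coord (P : mpoly n R) : 'rV[R]_N :=
  \row_i mcoeff (bmnm (enum_val i)) P.

Definition mpoly_of_coord (v : 'rV[R]_N) : mpoly n R :=
  \sum_i v ord0 i *: mpolyX R (bmnm (enum_val i)).

Lemma mcoeff_of_coord (v : 'rV[R]_N) i :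
  mcoeff (bmnm (enum_val i)) (mpoly_of_coord v) = v ord0 i.
Proof.
rewrite /mpoly_of_coord raddf_sum/= (bigD1 i)//= mcoeffZ mcoeffX eqxx mulr1.
rewrite big1 ?addr0// => j ji; rewrite mcoeffZ mcoeffX.
by rewrite (_ : _ == _ = false) ?mulr0// -bmeqP (inj_eq enum_val_inj) (negbTE ji).
Qed.

Lemma mpoly_of_coord_neq0 (v : 'rV[R]_N) : v != 0 -> mpoly_of_coord v != 0.
Proof.
apply: contraNneq => v0; apply/eqP/rowP => i.
by rewrite -mcoeff_of_coord v0 mcoeff0 mxE.
Qed.

Lemma mpoly_of_coordK (P : mpoly n R) : Pi_space m P ->
  mpoly_of_coord (mpoly_coord P) = P.
Proof.
move=> Pm; rewrite [RHS](mpolywE Pm) /mpoly_of_coord.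
rewrite [RHS](reindex (@enum_val _ predT)) /=; last first.
  exact/onW_bij/enum_val_bij.
by apply: eq_bigr => i _; rewrite mxE.
Qed.

Lemma Pi_space_of_coord (v : 'rV[R]_N) : Pi_space m (mpoly_of_coord v).
Proof.
rewrite /Pi_space/= msizeE; apply/bigmax_leqP_seq => k + _.
rewrite mcoeff_msupp ltnNge; apply: contraNN => mk.
rewrite /mpoly_of_coord raddf_sum/= big1// => i _.
rewrite mcoeffZ mcoeffX; case: eqP => [ik|]; last by rewrite mulr0.
by move: (bmdeg (enum_val i)); rewrite ik ltnNge mk.
Qed.

Lemma poly_fun_of_coord (v : 'rV[R]_N) (x : Rn R n) :
  poly_fun (mpoly_of_coord v) x =
  \sum_i v ord0 i * poly_fun (mpolyX R (bmnm (enum_val i))) x.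
Proof.
by rewrite /poly_fun /mpoly_of_coord raddf_sum/=; apply: eq_bigr => i _; rewrite mevalZ.
Qed.

Lemma coord_le_norm (v : 'rV[R]_N) i : `|v ord0 i| <= `|v|.
Proof.
rewrite [leRHS]/Num.Def.normr /= mx_normrE; apply/bigmax_geP; right => /=.
by exists (ord0, i).
Qed.

End mpoly_coordinates.

(** * Convergence of best approximations *)

Section mu_psi_plus_rates.
Context (R : realType) (n : nat) (Omega : set (Rn R n)) (phi : R -> R).
Hypothesis mOm : measurable Omega.
Local Notation p := (psi_plus phi).
Local Notation q := (psi_minus phi).
Hypothesis p0 : p 0 = 0.
Hypothesis pq_lt : forall s t, 0 <= s -> s < t -> p s < q t.
Hypothesis qp_le : forall t, 0 <= t -> q t <= p t.

Lemma mu_psi_plus_rates m (f : Rn R n -> R) (P Q : mpoly n R) :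
  measurable_fun Omega f -> mu_psi_plus Omega phi m f P -> Pi_space m Q ->
  (\int[@lebesgue_Rn R n]_(x in Omega)
     (drop_rate q (f x - poly_fun P x) (poly_fun Q x))%:E <=
   \int[@lebesgue_Rn R n]_(x in Omega)
     (rise_rate p (f x - poly_fun P x) (poly_fun Q x))%:E)%E.
Proof.
move=> mf [_ Pmu] Qm; have := Pmu Q Qm; rewrite /weighted_integral.
have mu_ : measurable_fun Omega (fun x => f x - poly_fun P x).
  by apply: measurable_funB => //; exact: measurable_poly_fun.
have mc : measurable_fun Omega (poly_fun Q) by exact: measurable_poly_fun.
(* Reversing the sign of the residual turns a rise into a drop, so one splitting lemma serves both
   sides of the inequality. *)
have rateE : (fun x => rise_rate p (f x - poly_fun P x) (poly_fun Q x)) =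
    (fun x => drop_rate p (- (f x - poly_fun P x)) (poly_fun Q x)).
  by apply/funext => x; rewrite /rise_rate /drop_rate mulNr oppr_gt0 normrN.
have dropE := @integral_drop_rate_split _ _ _ (@lebesgue_Rn R n) Omega q _ _ mOm mu_ mc
  (measurable_drop_rate p0 pq_lt qp_le mu_ mc) (fun x _ => drop_rate_ge0 p0 pq_lt _ _).
have mr := measurable_rise_rate pq_lt qp_le mu_ mc; rewrite rateE in mr.
have riseE := @integral_drop_rate_split _ _ _ (@lebesgue_Rn R n) Omega p _ _ mOm
  (measurable_funN mu_) mc mr.
have r0 x : Omega x ->
    0 <= drop_rate p (- (f x - poly_fun P x)) (poly_fun Q x).
  have := rise_rate_ge0 p0 pq_lt qp_le (f x - poly_fun P x) (poly_fun Q x).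
  by rewrite /rise_rate /drop_rate mulNr oppr_gt0 normrN.
have {}riseE := riseE r0.
rewrite -dropE.
have -> : (\int[@lebesgue_Rn R n]_(x in Omega)
    (rise_rate p (f x - poly_fun P x) (poly_fun Q x))%:E =
    \int[@lebesgue_Rn R n]_(x in Omega)
    (drop_rate p (- (f x - poly_fun P x)) (poly_fun Q x))%:E)%E.
  by apply: eq_integral => x _; congr EFin; exact: (congr1 (fun F => F x) rateE).
rewrite -riseE.
rewrite -(_ : [set x | poly_fun P x < f x /\ 0 < poly_fun Q x] =
  [set x | 0 < f x - poly_fun P x /\ 0 < poly_fun Q x]); last first.
  by apply/seteqP; split => x /=; rewrite subr_gt0.
rewrite -(_ : [set x | f x < poly_fun P x /\ poly_fun Q x < 0] =
  [set x | f x - poly_fun P x < 0 /\ poly_fun Q x < 0]); last first.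
  by apply/seteqP; split => x /=; rewrite subr_lt0.
rewrite -(_ : [set x | f x < poly_fun P x /\ 0 < poly_fun Q x] =
  [set x | 0 < - (f x - poly_fun P x) /\ 0 < poly_fun Q x]); last first.
  by apply/seteqP; split => x /=; rewrite oppr_gt0 subr_lt0.
rewrite -(_ : [set x | poly_fun P x < f x /\ poly_fun Q x < 0] =
  [set x | - (f x - poly_fun P x) < 0 /\ poly_fun Q x < 0]); last first.
  by apply/seteqP; split => x /=; rewrite oppr_lt0 subr_gt0.
move=> /le_trans; apply; rewrite le_eqVlt; apply/orP; left; apply/eqP.
by congr (_ + _)%E; apply: eq_integral => x _; rewrite normrN.
Qed.

End mu_psi_plus_rates.

(** Coefficients of degree above [m] vanish throughout; the others are coordinates, controlled by
    the norm. *)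
Lemma poly_cvg_of_coord (R : realType) n m (P_ : nat -> mpoly n R) (P : mpoly n R) :
  (forall k, Pi_space m (P_ k)) -> Pi_space m P ->
  (mpoly_coord m (P_ k) - mpoly_coord m P) @[k --> \oo] -->
    (0 : 'rV[R]_#|{: bmultinom n m.+1}|) ->
  poly_cvg P_ P.
Proof.
move=> Pm_ Pm cvgP k; have [km|mk] := ltnP (mdeg k) m.+1; last first.
  have null Q : Pi_space m Q -> mcoeff k Q = 0.
    by move=> Qm; apply/memN_msupp_eq0/msize_mdeg_ge; exact: leq_trans Qm mk.
  by under eq_fun do rewrite null//; rewrite null//; exact: cvg_cst.
apply/cvgrPdist_lt => eps eps0.
move/cvgrPdist_lt : cvgP => /(_ _ eps0); apply: filterS => i.
rewrite sub0r normrN; apply: le_lt_trans.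
have := coord_le_norm (mpoly_coord m (P_ i) - mpoly_coord m P)
  (enum_rank (BMultinom km)).
by rewrite !mxE enum_rankK/= distrC.
Qed.

Unset Implicit Arguments.

Theorem theorem4p3 (R : realType) (n m : nat) (Omega : set (Rn R n))
    (hOm : measurable Omega) (hOb : bounded_Rn Omega)
    (hOp : (0 < @lebesgue_Rn R n Omega)%E)
    (phi : R -> R) (hphi : class_Phi phi)
    (hmono : {in `[0, +oo[ &, {homo psi_plus phi : x y / x < y}})
    (h_ : nat -> Rn R n -> R) (h H : Rn R n -> R)
    (hL_ : forall k, L_psi_plus Omega phi (h_ k))
    (hL : L_psi_plus Omega phi h)
    (hlim : (\int[@lebesgue_Rn R n]_(x in Omega)
               (psi_plus phi `|h_ k x - h x|)%:E)%E @[k --> \oo] --> 0%E)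
    (HL : L_psi_plus Omega phi H)
    (hdom : forall k,
      {ae @lebesgue_Rn R n, forall x, Omega x -> `|h_ k x| <= H x})
    (P_ : nat -> mpoly n R) (P : mpoly n R)
    (hP_ : forall k, mu_psi_plus Omega phi m (h_ k) (P_ k))
    (hP : mu_psi_plus Omega phi m h P) :
  poly_cvg P_ P.
Proof.
have [[psi psiS phiE] D2] := hphi.
have [q_bnd psi_p p_incr incr_q] := class_Phi_psi_bounds psiS phiE.
have p0 : psi_plus phi 0 = 0 by rewrite /psi_plus eqxx.
have qp_le t : 0 <= t -> psi_minus phi t <= psi_plus phi t.
  by move=> t0; have /andP[_ qt] := q_bnd t t0; exact: le_trans qt (psi_p t t0).
(* Strict monotonicity of [psi_plus] is used from [s] to the midpoint; the slope of the chord from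
   the midpoint to [t] then leads to [psi_minus] at [t]. *)
have pq_lt s t : 0 <= s -> s < t -> psi_plus phi s < psi_minus phi t.
  move=> s0 st; have s_mid := midf_lt st.
  have mid0 : 0 <= (s + t) / 2 := le_trans s0 (ltW s_mid.1).
  apply: lt_le_trans (_ : psi_plus phi ((s + t) / 2) <= _).
    by apply: hmono; rewrite ?in_itv/= ?andbT// s_mid.1.
  have t_mid : 0 < t - (s + t) / 2 by rewrite subr_gt0 s_mid.2.
  rewrite -(ler_pM2r t_mid).
  exact: le_trans (p_incr _ _ mid0 s_mid.2) (incr_q _ _ mid0 s_mid.2).
have [C C0 p_doubling] := class_Phi_psi_Delta2 hphi.
pose D k := mpoly_coord m (P_ k) - mpoly_coord m P.
have Pm_ k : Pi_space m (P_ k) := (hP_ k).1.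
have Pm : Pi_space m P := hP.1.
apply: (@poly_cvg_of_coord _ _ m) => //.
apply: contrapT => Dn0.
have [eps [v [E [s [i [eps0 v0 Ev EP]]]]]] := sphere_extraction hlim Dn0.
pose e_ j := poly_fun (mpoly_of_coord (E j)).
pose e := poly_fun (mpoly_of_coord v).
have PE j x : poly_fun (P_ (i j)) x = poly_fun P x + s j * e_ j x.
  have [_ DE _ _] := EP j.
  rewrite -(mpoly_of_coordK (Pm_ (i j))) -[X in poly_fun X x + _](mpoly_of_coordK Pm).
  rewrite /e_ !poly_fun_of_coord mulr_sumr -big_split/=; apply: eq_bigr => l _.
  rewrite mulrA -mulrDl; congr (_ * _).
  have /rowP/(_ l) := DE; rewrite !mxE => /eqP.
  by rewrite subr_eq addrC => /eqP.
pose mon (l : 'I_#|{: bmultinom n m.+1}|) := mpolyX R (bmnm (enum_val l)).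
have [B BP] : {B : 'I_#|{: bmultinom n m.+1}| -> R & forall l,
    0 <= B l /\ forall x, Omega x -> `|poly_fun (mon l) x| <= B l}.
  apply: (@choice _ _ (fun l b => 0 <= b /\
    forall x, Omega x -> `|poly_fun (mon l) x| <= b)) => l.
  by have [b b0 bP] := poly_fun_bounded (mon l) hOb; exists b.
have [KP KP0 KPB] := poly_fun_bounded P hOb.
(* A common bound on [Omega] for [P] and all [e_ j]: the coordinates of [E j] are at most [eps], and
   the [l]-th monomial is at most [B l]. *)
pose K := KP + \sum_l eps * B l.
have sum0 : 0 <= \sum_l eps * B l.
  by apply: sumr_ge0 => l _; rewrite mulr_ge0// (BP l).1.
have me_ j : measurable_fun Omega (e_ j) by exact: measurable_poly_fun.
have mPf : measurable_fun Omega (poly_fun P) by exact: measurable_poly_fun.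
have finOm : (@lebesgue_Rn R n Omega < +oo)%E by exact: bounded_Rn_finite.
apply: (@no_common_descent _ _ R (@lebesgue_Rn R n) _ _ Omega p0 pq_lt qp_le C C0
  p_doubling hOm hOp finOm h H (poly_fun P) (h_ \o i) e_ e K).
- exact: hL.1.
- exact: HL.1.
- exact: mPf.
- by move=> j; exact: (hL_ _).1.
- exact: me_.
- exact: hL.2.
- exact: HL.2.
- by move=> j; exact: hdom.
- by move=> j; have [_ _ _] := EP j.
- by rewrite addr_ge0.
- by move=> x Ox; rewrite (le_trans (KPB x Ox))// lerDl.
- move=> j x Ox; have [_ _ nE _] := EP j.
  rewrite /e_ poly_fun_of_coord (le_trans (ler_norm_sum _ _ _))//.
  apply: (@le_trans _ _ (\sum_l eps * B l)); last by rewrite lerDr.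
  apply: ler_sum => l _; rewrite normrM ler_pM//; last exact: (BP l).2.
  exact: le_trans (coord_le_norm _ _) nE.
- move=> x _; rewrite /e poly_fun_of_coord.
  rewrite (_ : (fun j => e_ j x) = (fun j => \sum_l
      E j ord0 l * poly_fun (mon l) x)).
    apply: cvg_big => [|l _]; first exact: add_continuous.
    apply: cvgM; last exact: cvg_cst.
    exact: (cvg_comp _ _ Ev (@coord_continuous _ _ _ ord0 l v)).
  by apply/funext => j; rewrite /e_ poly_fun_of_coord.
- by apply: filterS (poly_fun_neq0_ae (mpoly_of_coord_neq0 v0)) => x + _.
(* Optimality of [P] for [h], tested in the direction [E j]. *)
- move=> j; apply: (mu_psi_plus_rates hOm p0 pq_lt qp_le hL.1 hP).
  exact: Pi_space_of_coord.
(* Optimality of [P_ (i j)] for [h_ (i j)], tested in the direction [- E j] towards [P], then moved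
   along the segment to [P + E j]. *)
- move=> j; have [s1 _ _ _] := EP j.
  have mhi := (hL_ (i j)).1.
  have Nm : Pi_space m (mpoly_of_coord (- E j)) by exact: Pi_space_of_coord.
  have NE x : poly_fun (mpoly_of_coord (- E j)) x = - e_ j x.
    rewrite /e_ !poly_fun_of_coord -sumrN; apply: eq_bigr => l _.
    by rewrite mxE mulNr.
  have uE x : h_ (i j) x - poly_fun (P_ (i j)) x =
      h_ (i j) x - poly_fun P x - s j * e_ j x by rewrite PE opprD addrA.
  have dE : (fun x => (drop_rate (psi_minus phi) (h_ (i j) x - poly_fun (P_ (i j)) x)
        (poly_fun (mpoly_of_coord (- E j)) x))%:E) =
      (fun x => (drop_rate (psi_minus phi) (h_ (i j) x - poly_fun P x - s j * e_ j x)
        (- e_ j x))%:E) by apply/funext => x; rewrite uE NE.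
  have rE : (fun x => (rise_rate (psi_plus phi) (h_ (i j) x - poly_fun (P_ (i j)) x)
        (poly_fun (mpoly_of_coord (- E j)) x))%:E) =
      (fun x => (rise_rate (psi_plus phi) (h_ (i j) x - poly_fun P x - s j * e_ j x)
        (- e_ j x))%:E) by apply/funext => x; rewrite uE NE.
  have := mu_psi_plus_rates hOm p0 pq_lt qp_le mhi (hP_ (i j)) Nm.
  rewrite dE rE.
  exact: (integral_rates_segment p0 pq_lt qp_le hOm
    (measurable_funB mhi mPf) (me_ j) s1).
Qed.
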